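(* Let $H=\{H_\alpha\}_{\alpha\in\pi}$ be a finite dimensional quasitriangular Hopf $\pi$-coalgebra with crossing $\varphi$ and $R$-matrix $R=\{R_{\alpha,\beta}\}_{\alpha,\beta\in\pi}$. Let $g=(g_\alpha)_{\alpha\in\pi}$ be the distinguished $\pi$-grouplike element of $H$, let $\nu$ be the distinguished grouplike element of $H_1^*$, let $\ell=(\ell_\alpha)_{\alpha\in\pi}$ be the $\pi$-grouplike element $\ell_\alpha=S_{\alpha^{-1}}(u_{\alpha^{-1}})^{-1}u_\alpha$, where the $u_\alpha$ are the Drinfeld elements of $H$, and let $\widehat\varphi:\pi\to\Bbbk^*$ be the unique group homomorphism such that $\lambda_{\beta\alpha\beta^{-1}}\varphi_\beta=\widehat\varphi(\beta)\lambda_\alpha$ for all $\alpha,\beta\in\pi$ and every left or right $\pi$-integral $\lambda=(\lambda_\alpha)_{\alpha\in\pi}$ for $H$. Define $h_\alpha=(\mathrm{id}_{H_\alpha}\otimes\nu)(R_{\alpha,1})$ for $\alpha\in\pi$. Then: (a) $h=(h_\alpha)_{\alpha\in\pi}$ is a $\pi$-grouplike element of $H$; (b) $g=\widehat\varphi^{-1}\ell h$ in $G(H)$, i.e. $g_\alpha=\widehat\varphi(\alpha)^{-1}\ell_\alpha h_\alpha$ for all $\alpha\in\pi$.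
   Context: Throughout, $\pi$ is a discrete group with neutral element $1$, $\Bbbk$ is a field, $\Bbbk^*=\Bbbk\setminus\{0\}$, $\otimes=\otimes_\Bbbk$, and algebras are associative and unital over $\Bbbk$ (the zero algebra is allowed). A $\pi$-coalgebra is a family $C=\{C_\alpha\}_{\alpha\in\pi}$ of $\Bbbk$-spaces with $\Bbbk$-linear maps $\Delta_{\alpha,\beta}:C_{\alpha\beta}\to C_\alpha\otimes C_\beta$ and $\epsilon:C_1\to\Bbbk$ such that $(\Delta_{\alpha,\beta}\otimes\mathrm{id}_{C_\gamma})\Delta_{\alpha\beta,\gamma}=(\mathrm{id}_{C_\alpha}\otimes\Delta_{\beta,\gamma})\Delta_{\alpha,\beta\gamma}$ and $(\mathrm{id}_{C_\alpha}\otimes\epsilon)\Delta_{\alpha,1}=\mathrm{id}_{C_\alpha}=(\epsilon\otimes\mathrm{id}_{C_\alpha})\Delta_{1,\alpha}$ for all $\alpha,\beta,\gamma\in\pi$. A Hopf $\pi$-coalgebra is a $\pi$-coalgebra $H=(\{H_\alpha\},\Delta,\epsilon)$ with $\Bbbk$-linear maps $S_\alpha:H_\alpha\to H_{\alpha^{-1}}$ such that each $H_\alpha$ is an algebra with multiplication $m_\alpha$ and unit $1_\alpha$, the maps $\epsilon$ and all $\Delta_{\alpha,\beta}$ are algebra homomorphisms, and $m_\alpha(S_{\alpha^{-1}}\otimes\mathrm{id}_{H_\alpha})\Delta_{\alpha^{-1},\alpha}=\epsilon 1_\alpha=m_\alpha(\mathrm{id}_{H_\alpha}\otimes S_{\alpha^{-1}})\Delta_{\alpha,\alpha^{-1}}$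 for all $\alpha$. $H_1$ is an ordinary Hopf algebra. $H$ is finite dimensional if every $H_\alpha$ is. A crossed Hopf $\pi$-coalgebra is one endowed with a crossing: $\Bbbk$-linear maps $\varphi_\beta:H_\alpha\to H_{\beta\alpha\beta^{-1}}$ ($\alpha,\beta\in\pi$) that are algebra isomorphisms with $(\varphi_\beta\otimes\varphi_\beta)\Delta_{\alpha,\gamma}=\Delta_{\beta\alpha\beta^{-1},\beta\gamma\beta^{-1}}\varphi_\beta$, $\epsilon\varphi_\beta=\epsilon$, and $\varphi_{\beta\beta'}=\varphi_\beta\varphi_{\beta'}$. Let $\sigma_{\beta,\alpha}:H_\beta\otimes H_\alpha\to H_\alpha\otimes H_\beta$ be the flip. A quasitriangular Hopf $\pi$-coalgebra is a crossed one with invertible elements $R_{\alpha,\beta}\in H_\alpha\otimes H_\beta$ ($\alpha,\beta\in\pi$) such that for all $\alpha,\beta,\gamma\in\pi$: (i) $R_{\alpha,\beta}\cdot\Delta_{\alpha,\beta}(x)=\sigma_{\beta,\alpha}(\varphi_{\alpha^{-1}}\otimes\mathrm{id}_{H_\alpha})\Delta_{\alpha\beta\alpha^{-1},\alpha}(x)\cdot R_{\alpha,\beta}$ for all $x\in H_{\alpha\beta}$; (ii) $(\mathrm{id}_{H_\alpha}\otimes\Delta_{\beta,\gamma})(R_{\alpha,\beta\gamma})=(R_{\alpha,\gamma})_{1\beta3}\cdot(R_{\alpha,\beta})_{12\gamma}$ and $(\Delta_{\alpha,\beta}\otimes\mathrm{id}_{H_\gamma})(R_{\alpha\beta,\gamma})=[(\mathrm{id}_{H_\alpha}\otimes\varphi_{\beta^{-1}})(R_{\alpha,\beta\gamma\beta^{-1}})]_{1\beta3}\cdot(R_{\beta,\gamma})_{\alpha23}$,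 where for $r=\sum_jp_j\otimes q_j$ one sets $r_{12\gamma}=r\otimes1_\gamma$, $r_{\alpha23}=1_\alpha\otimes r$, $r_{1\beta3}=\sum_jp_j\otimes1_\beta\otimes q_j$; (iii) $(\varphi_\beta\otimes\varphi_\beta)(R_{\alpha,\gamma})=R_{\beta\alpha\beta^{-1},\beta\gamma\beta^{-1}}$. Its Drinfeld elements are $u_\alpha=m_\alpha(S_{\alpha^{-1}}\varphi_\alpha\otimes\mathrm{id}_{H_\alpha})\sigma_{\alpha,\alpha^{-1}}(R_{\alpha,\alpha^{-1}})\in H_\alpha$; they are invertible. A left (resp. right) $\pi$-integral for $H$ is a family $\lambda\in\prod_\alpha H_\alpha^*$ with $(\mathrm{id}_{H_\alpha}\otimes\lambda_\beta)\Delta_{\alpha,\beta}=\lambda_{\alpha\beta}\,1_\alpha$ (resp. $(\lambda_\alpha\otimes\mathrm{id}_{H_\beta})\Delta_{\alpha,\beta}=\lambda_{\alpha\beta}\,1_\beta$) for all $\alpha,\beta$. A $\pi$-grouplike element of $H$ is a family $g=(g_\alpha)\in\prod_\alpha H_\alpha$ with $\Delta_{\alpha,\beta}(g_{\alpha\beta})=g_\alpha\otimes g_\beta$ for all $\alpha,\beta$ and $\epsilon(g_1)=1$. The set $G(H)$ of these is a group under componentwise multiplication, on which $\mathrm{Hom}(\pi,\Bbbk^* )$ acts by $\phi g=(\phi(\alpha)g_\alpha)_\alpha$. The distinguished $\pi$-grouplike element of a finite dimensional $H$ is the unique $\pi$-grouplike element $g$ with $(\mathrm{id}_{H_\alpha}\otimes\lambda_\beta)\Delta_{\alpha,\beta}=\lambda_{\alpha\beta}\,g_\alpha$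 for every right $\pi$-integral $\lambda$ and all $\alpha,\beta$. The distinguished grouplike element of $H_1^*$ is the unique algebra morphism $\nu:H_1\to\Bbbk$ such that $\Lambda x=\nu(x)\Lambda$ for all $x\in H_1$ and every left integral $\Lambda$ for $H_1$ (i.e. $\Lambda\in H_1$ with $x\Lambda=\epsilon(x)\Lambda$ for all $x\in H_1$). *)

(* Defs.v *)
From HB Require Import structures.
From mathcomp Require Import all_boot all_algebra.
From mathcomp Require Import boolp classical_sets.

Set Implicit Arguments.
Unset Strict Implicit.
Unset Printing Implicit Defensive.

Import GRing.Theory VectorInternalTheory.
Local Open Scope ring_scope.

Section Bilinear.
Variables (K : fieldType) (U V W : lmodType K).

Definition bilin (b : U -> V -> W) : Prop :=
  (forall u, linear (b u)) /\ (forall v, linear (b^~ v)).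
End Bilinear.

(* Finite dimensional associative unital K-algebras. The library's lalgType,  *)
(* algType and falgType all require 1 != 0, whereas the zero algebra is       *)
(* allowed here, and its hierarchy leaves no room for a structure joining     *)
(* vectType and pzRingType, hence the separate operations.                    *)
HB.mixin Record Vector_isFdAlg (K : fieldType) A of Vector K A := {
  aone : A;
  amul : A -> A -> A;
  amulA : associative amul;
  amul1l : left_id aone amul;
  amul1r : right_id aone amul;
  amul_bilin : bilin amul;
}.

#[short(type="fdAlgType")]
HB.structure Definition FdAlg (K : fieldType) :=
  {A of Vector K A & Vector_isFdAlg K A}.

Bind Scope ring_scope with FdAlg.sort.
Arguments aone {K} A : rename.

Notation "x ∙ y" := (amul x y) (at level 40, left associativity) : ring_scope.

Section FdAlgDefs.
Variable K : fieldType.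

Fact regular_mul_bilin : bilin ( *%R : K^o -> K^o -> K^o).
Proof.
by split=> u c x y; rewrite /= ?mulrDr ?mulrDl -?scalerAr -?scalerAl.
Qed.
HB.instance Definition _ := Vector_isFdAlg.Build K K^o
  (@mulrA K) (@mul1r K) (@mulr1 K) regular_mul_bilin.

Definition multiplicative_unital (A B : fdAlgType K) (f : A -> B) : Prop :=
  f (aone A) = aone B /\ {morph f : x y / x ∙ y}.

Definition inverse_of (A : fdAlgType K) (x y : A) : Prop :=
  x ∙ y = aone A /\ y ∙ x = aone A.

(* The inverse of x if x is invertible, 0 otherwise. *)
Definition ainv (A : fdAlgType K) (x : A) : A :=
  xget 0 [set y | inverse_of x y]%classic.
End FdAlgDefs.

(* U (x) V for finite dimensional spaces: the matrices indexed by the bases   *)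
(* of U and V, a pure tensor being an outer product of coordinate vectors.    *)
(* The universal property is tens_bilinear, tliftE and tens_ext below.        *)
Section TensorSpace.
Variable K : fieldType.

Definition tensor (U V : vectType K) : Type := 'M[K]_(dim U, dim V).

HB.instance Definition _ (U V : vectType K) :=
  Vector.copy (tensor U V) 'M[K]_(dim U, dim V).

Definition tens (U V : vectType K) (u : U) (v : V) : tensor U V :=
  (v2r u)^T *m v2r v.

Definition vbase (U : vectType K) (i : 'I_(dim U)) : U := r2v (delta_mx 0 i).

(* The linear map induced by a bilinear map b. *)
Definition tlift (U V W : vectType K) (b : U -> V -> W) (x : tensor U V) : W :=
  \sum_i \sum_j (x : 'M_(_, _)) i j *: b (vbase i) (vbase j).
End TensorSpace.

Notation "u ⊗ v" := (tens u v) (at level 40, left associativity) : ring_scope.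

Section TensorTheory.
Variable K : fieldType.
Implicit Types U V W : vectType K.

Fact tlift_is_linear U V W (b : U -> V -> W) : linear (tlift b).
Proof.
move=> c x y; rewrite /tlift scaler_sumr -big_split /=; apply: eq_bigr => i _.
rewrite scaler_sumr -big_split /=; apply: eq_bigr => j _.
by rewrite !mxE scalerDl scalerA.
Qed.
HB.instance Definition _ U V W (b : U -> V -> W) :=
  GRing.isLinear.Build K (tensor U V) W _ (tlift b) (tlift_is_linear b).

Fact tlift_combl U V W (b b1 b2 : U -> V -> W) (c : K) (x : tensor U V) :
  (forall u v, b u v = c *: b1 u v + b2 u v) ->
  tlift b x = c *: tlift b1 x + tlift b2 x.
Proof.
move=> bE; rewrite /tlift scaler_sumr -big_split /=; apply: eq_bigr => i _.
rewrite scaler_sumr -big_split /=; apply: eq_bigr => j _.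
by rewrite bE scalerDr !scalerA [c * _]mulrC.
Qed.

Lemma tens_bilinear U V : bilin (@tens K U V).
Proof.
split=> [u|v] c x y; rewrite /tens.
  by rewrite linearP /= mulmxDr -scalemxAr.
by rewrite linearP /= linearP /= mulmxDl -scalemxAl.
Qed.

Lemma vbase_sum U (u : U) : u = \sum_i v2r u 0 i *: vbase i.
Proof.
apply: (can_inj v2rK); rewrite [LHS]row_sum_delta linear_sum /=.
by apply: eq_bigr => i _; rewrite linearZ /= r2vK.
Qed.

Lemma tensE U V (u : U) (v : V) i j :
  (u ⊗ v : 'M_(_, _)) i j = v2r u 0 i * v2r v 0 j.
Proof. by rewrite mxE big_ord1 !mxE. Qed.

Lemma tliftE U V W (b : U -> V -> W) (u : U) (v : V) :
  bilin b -> tlift b (u ⊗ v) = b u v.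
Proof.
case=> bl br.
pose bL u := HB.pack_for {linear V -> W} (b u)
  (GRing.isLinear.Build K V W _ (b u) (bl u)).
pose bR v := HB.pack_for {linear U -> W} (b^~ v)
  (GRing.isLinear.Build K U W _ (b^~ v) (br v)).
rewrite [in RHS](vbase_sum u) -[RHS]/(bR v _) linear_sum.
apply: eq_bigr => i _; rewrite linearZ /= [in RHS](vbase_sum v).
rewrite -[b _ _]/(bL _ _) linear_sum scaler_sumr.
by apply: eq_bigr => j _; rewrite linearZ /= tensE scalerA.
Qed.

Lemma tens_sum U V (x : tensor U V) :
  x = \sum_i \sum_j (x : 'M_(_, _)) i j *: (vbase i ⊗ vbase j).
Proof.
rewrite [LHS]matrix_sum_delta; apply: eq_bigr => i _; apply: eq_bigr => j _.
by rewrite /tens /vbase !r2vK trmx_delta mul_delta_mx.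
Qed.

Lemma tens_ext U V W (f g : {linear tensor U V -> W}) :
  (forall u v, f (u ⊗ v) = g (u ⊗ v)) -> f =1 g.
Proof.
move=> fg x; rewrite (tens_sum x) !linear_sum; apply: eq_bigr => i _.
by rewrite !linear_sum; apply: eq_bigr => j _; rewrite !linearZ /= fg.
Qed.
End TensorTheory.

Section TensorMaps.
Variable K : fieldType.
Implicit Types U V W : vectType K.

(* f (x) g; only meaningful for linear f and g. *)
Definition tmap U U' V V' (f : U -> U') (g : V -> V') :
    tensor U V -> tensor U' V' := tlift (fun u v => f u ⊗ g v).

Definition tswap U V : tensor U V -> tensor V U := tlift (fun u v => v ⊗ u).

Definition tassoc U V W : tensor (tensor U V) W -> tensor U (tensor V W) :=
  tlift (fun x w => tlift (fun u v => u ⊗ (v ⊗ w)) x).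

(* id (x) f and f (x) id for a linear form f, after U (x) K = U = K (x) U. *)
Definition tformr U V (f : V -> K) : tensor U V -> U :=
  tlift (fun u v => f v *: u).
Definition tforml U V (f : U -> K) : tensor U V -> V :=
  tlift (fun u v => f u *: v).

Definition tmulmap (A : fdAlgType K) : tensor A A -> A := tlift (@amul K A).

Lemma tens_inj_bilin U V U' V' (f : {linear U -> U'}) (g : {linear V -> V'}) :
  bilin (fun u v => f u ⊗ g v).
Proof.
have [tr tl] := tens_bilinear U' V'.
by split=> [u|v] c x y; rewrite linearP /=; [rewrite tr | rewrite [LHS](tl (g v))].
Qed.

Lemma tmapE U V U' V' (f : {linear U -> U'}) (g : {linear V -> V'}) u v :
  tmap f g (u ⊗ v) = f u ⊗ g v.
Proof. exact/tliftE/tens_inj_bilin. Qed.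

Lemma tswapE U V (u : U) (v : V) : tswap (u ⊗ v) = v ⊗ u.
Proof. by rewrite [LHS]tliftE //; case: (tens_bilinear V U). Qed.

Lemma tformrE U V (f : {linear V -> K^o}) (u : U) (v : V) :
  tformr f (u ⊗ v) = (f v : K) *: u.
Proof.
apply: tliftE; split=> [u0|v0] c x y.
  by rewrite linearP scalerDl /= scalerA.
by rewrite scalerDr !scalerA [c * _]mulrC.
Qed.

Lemma tformlE U V (f : {linear U -> K^o}) (u : U) (v : V) :
  tforml f (u ⊗ v) = (f u : K) *: v.
Proof.
apply: tliftE; split=> [u0|v0] c x y; last by rewrite linearP scalerDl scalerA.
by rewrite scalerDr !scalerA [c * _]mulrC.
Qed.

Lemma tmulmapE (A : fdAlgType K) (x y : A) : tmulmap (x ⊗ y) = x ∙ y.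
Proof. exact/tliftE/amul_bilin. Qed.

Lemma tassocE U V W (u : U) (v : V) (w : W) :
  tassoc (u ⊗ v ⊗ w) = u ⊗ (v ⊗ w).
Proof.
have [tr tl] := tens_bilinear U (tensor V W).
have [tr' tl'] := tens_bilinear V W.
have b2 (w0 : W) : bilin (fun (u : U) (v : V) => u ⊗ (v ⊗ w0)).
  by split=> [u0|v0] c x y; [rewrite (tl' w0) tr | rewrite [LHS](tl (v0 ⊗ w0))].
rewrite /tassoc tliftE ?tliftE //; split=> [x|w0]; last exact: tlift_is_linear.
by move=> c y z; apply: tlift_combl => u0 v0; rewrite tr' tr.
Qed.
End TensorMaps.

(* The algebra A (x) B, with (a (x) b)(a' (x) b') = aa' (x) bb'. *)
Section TensorAlgebra.
Variables (K : fieldType) (A B : fdAlgType K).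
Implicit Types x y z : tensor A B.

Definition talg_one : tensor A B := aone A ⊗ aone B.

Definition talg_mul x y : tensor A B :=
  tlift (fun a b => tlift (fun a' b' => (a ∙ a') ⊗ (b ∙ b')) y) x.

Fact talg_mulr_bilin (a : A) (b : B) :
  bilin (fun (a' : A) (b' : B) => (a ∙ a') ⊗ (b ∙ b')).
Proof.
have [tr tl] := tens_bilinear A B; have [+ _] := @amul_bilin K A.
have [+ _] := @amul_bilin K B => lB lA.
by split=> [u|v] s x y; [rewrite lB tr | rewrite lA [LHS](tl (b ∙ v))].
Qed.

Fact talg_mul_bilin : bilin talg_mul.
Proof.
split=> [x|y] s => [y z|x z]; last by rewrite /talg_mul tlift_is_linear.
by apply: tlift_combl => u v; apply: tlift_is_linear.
Qed.

Lemma talg_mulE (a a' : A) (b b' : B) :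
  talg_mul (a ⊗ b) (a' ⊗ b') = (a ∙ a') ⊗ (b ∙ b').
Proof.
have [tr tl] := tens_bilinear A B; have [_ rA] := @amul_bilin K A.
have [_ rB] := @amul_bilin K B.
rewrite /talg_mul tliftE; first exact/tliftE/talg_mulr_bilin.
split=> [u|v] s x y; apply: tlift_combl => u' v'; first by rewrite (rB v') tr.
by rewrite (rA u') [LHS](tl (v ∙ v')).
Qed.

Let lin_ext (f g : tensor A B -> tensor A B) : linear f -> linear g ->
  (forall u v, f (u ⊗ v) = g (u ⊗ v)) -> f =1 g.
Proof.
move=> lf lg fg.
pose f' := HB.pack_for {linear _ -> _} f
  (GRing.isLinear.Build K _ (tensor A B) _ f lf).
pose g' := HB.pack_for {linear _ -> _} g
  (GRing.isLinear.Build K _ (tensor A B) _ g lg).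
exact: (@tens_ext _ _ _ _ f' g').
Qed.

Fact talg_mulA : associative talg_mul.
Proof.
have [lr ll] := talg_mul_bilin.
move=> x y z; move: x; apply: lin_ext => [s u v|s u v|a b].
- exact: ll.
- by rewrite (ll y) (ll z).
move: y; apply: lin_ext => [s u v|s u v|a' b'].
- by rewrite (ll z) lr.
- by rewrite lr (ll z).
move: z; apply: lin_ext => [s u v|s u v|a'' b''].
- by rewrite !lr.
- by rewrite lr.
by rewrite !talg_mulE !amulA.
Qed.

Fact talg_mul1l : left_id talg_one talg_mul.
Proof.
have [lr ll] := talg_mul_bilin.
by apply: lin_ext => // a b; rewrite talg_mulE !amul1l.
Qed.

Fact talg_mul1r : right_id talg_one talg_mul.
Proof.
have [lr ll] := talg_mul_bilin.
by apply: lin_ext => [|//|a b]; [exact: ll | rewrite talg_mulE !amul1r].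
Qed.

HB.instance Definition _ := Vector_isFdAlg.Build K (tensor A B)
  talg_mulA talg_mul1l talg_mul1r talg_mul_bilin.

Lemma tens_mulE (a a' : A) (b b' : B) :
  (a ⊗ b) ∙ (a' ⊗ b') = (a ∙ a') ⊗ (b ∙ b').
Proof. exact: talg_mulE. Qed.

Lemma tens_oneE : aone (tensor A B) = aone A ⊗ aone B.
Proof. by []. Qed.
End TensorAlgebra.

Section GroupIndex.
Variable G : groupType.
Implicit Types a b c : G.
Local Open Scope group_scope.

(* The library's a ^ b is b^-1 * a * b. *)
Definition lconj b a : G := b * a * b^-1.

Lemma lconjM b a c : lconj b (a * c) = lconj b a * lconj b c.
Proof. by rewrite /lconj !mulgA mulgVK. Qed.
Lemma lconj1 b : lconj b 1 = 1.
Proof. by rewrite /lconj mulg1 mulgV. Qed.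
Lemma lconjMl b b' a : lconj b (lconj b' a) = lconj (b * b') a.
Proof. by rewrite /lconj invgM !mulgA. Qed.
Lemma lconjK b a : lconj b^-1 (lconj b a) = a.
Proof. by rewrite lconjMl mulVg /lconj mul1g invg1 mulg1. Qed.
Lemma lconj_mul a b : lconj a b * a = a * b.
Proof. by rewrite /lconj mulgVK. Qed.
Lemma lconj_inv a : lconj a a^-1 = a^-1.
Proof. by rewrite /lconj mulgV mul1g. Qed.
End GroupIndex.

(* Transport between components whose indices are provably equal. *)
Section Cast.
Variables (K : fieldType) (I : Type) (C : I -> vectType K).

Definition icast (i j : I) (e : i = j) : C i -> C j :=
  let: erefl in _ = j := e return C i -> C j in id.

Fact icast_is_linear i j (e : i = j) : linear (icast e).
Proof. by case: _ / e. Qed.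
HB.instance Definition _ i j (e : i = j) :=
  GRing.isLinear.Build K (C i) (C j) _ (icast e) (icast_is_linear e).
End Cast.
Arguments icast {K I} C {i j} e _.

Definition is_pi_coalgebra (K : fieldType) (G : groupType) (C : G -> vectType K)
    (D : forall a b : G, {linear C (a * b)%g -> tensor (C a) (C b)})
    (eps : {linear C 1%g -> K^o}) : Prop :=
  [/\ forall a b c (x : C (a * b * c)%g),
        tassoc (tmap (D a b) id (D (a * b)%g c x)) =
        tmap id (D b c) (D a (b * c)%g (icast C (esym (mulgA a b c)) x)),
      forall a (x : C a),
        tformr eps (D a 1%g (icast C (esym (mulg1 a)) x)) = x
    & forall a (x : C a),
        tforml eps (D 1%g a (icast C (esym (mul1g a)) x)) = x].

Section Hopf.
Variables (K : fieldType) (G : groupType).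
Implicit Types a b c : G.

Section Laws.
Variable H : G -> fdAlgType K.
Local Notation cast e := (icast (fun a => H a) e).

Definition antipode_axiom
    (D : forall a b, {linear H (a * b)%g -> tensor (H a) (H b)})
    (eps : {linear H 1%g -> K^o}) (S : forall a, {linear H a -> H a^-1%g}) :
    Prop :=
  forall a (x : H 1%g),
    let Sa := cast (invgK a) \o S a^-1%g in
    tmulmap (tmap Sa id (D a^-1%g a (cast (esym (mulVg a)) x))) =
      (eps x : K) *: aone (H a)
    /\
    tmulmap (tmap id Sa (D a a^-1%g (cast (esym (mulgV a)) x))) =
      (eps x : K) *: aone (H a).

Definition crossing_axiom
    (D : forall a b, {linear H (a * b)%g -> tensor (H a) (H b)})
    (eps : {linear H 1%g -> K^o})
    (phi : forall b a, {linear H a -> H (lconj b a)}) : Prop :=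
  [/\ forall b a, multiplicative_unital (phi b a) /\ bijective (phi b a),
      forall b a c (x : H (a * c)%g),
        tmap (phi b a) (phi b c) (D a c x) =
        D (lconj b a) (lconj b c) (cast (lconjM b a c) (phi b (a * c)%g x)),
      forall b (x : H 1%g), eps (cast (lconj1 b) (phi b 1%g x)) = eps x
    & forall b b' a (x : H a),
        phi (b * b')%g a x = cast (lconjMl b b' a) (phi b _ (phi b' a x))].
End Laws.

(* As the H_a are fdAlgTypes, these are the finite dimensional ones. *)
Record hopfPiCoalg := HopfPiCoalg {
  hcar :> G -> fdAlgType K;
  hDelta : forall a b, {linear hcar (a * b)%g -> tensor (hcar a) (hcar b)};
  heps : {linear hcar 1%g -> K^o};
  hS : forall a, {linear hcar a -> hcar a^-1%g};
  hcoalgP : is_pi_coalgebra (C := fun a => hcar a) hDelta heps;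
  hDelta_alg : forall a b, multiplicative_unital (hDelta a b);
  heps_alg : multiplicative_unital heps;
  hSP : antipode_axiom hDelta heps hS;
}.

Record crossedHopfPiCoalg := CrossedHopfPiCoalg {
  chopf :> hopfPiCoalg;
  hphi : forall b a, {linear chopf a -> chopf (lconj b a)};
  hphiP : crossing_axiom (@hDelta chopf) (@heps chopf) hphi;
}.

Local Notation hcast H e := (icast (fun a => hcar H a) e).

(* phi_{b^-1} : H_{b a b^-1} -> H_a *)
Definition hphiV (H : crossedHopfPiCoalg) b a (x : H (lconj b a)) : H a :=
  hcast H (lconjK b a) (hphi H b^-1%g (lconj b a) x).

Section Quasitriangular.
Variable H : crossedHopfPiCoalg.

(* r_{12c}, r_{a23} and r_{1b3}, all in H_a (x) (H_b (x) H_c) *)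
Definition leg12 a b c (r : tensor (H a) (H b)) :
    tensor (H a) (tensor (H b) (H c)) := tassoc (r ⊗ aone (H c)).
Definition leg23 a b c (r : tensor (H b) (H c)) :
    tensor (H a) (tensor (H b) (H c)) := aone (H a) ⊗ r.
Definition leg13 a b c (r : tensor (H a) (H c)) :
    tensor (H a) (tensor (H b) (H c)) :=
  tlift (fun p q => p ⊗ (aone (H b) ⊗ q)) r.

Definition Rmatrix_axiom (R : forall a b, tensor (H a) (H b)) : Prop :=
  [/\ forall a b, exists r, inverse_of (R a b) r,
      forall a b (x : H (a * b)%g),
        R a b ∙ hDelta H a b x =
        tswap (tmap (@hphiV H a b) id
          (hDelta H (lconj a b) a (hcast H (esym (lconj_mul a b)) x))) ∙ R a b,
      forall a b c,
        tmap id (hDelta H b c) (R a (b * c)%g) =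
        leg13 b (R a c) ∙ leg12 c (R a b),
      forall a b c,
        tassoc (tmap (hDelta H a b) id (R (a * b)%g c)) =
        leg13 b (tmap id (@hphiV H b c) (R a (lconj b c))) ∙ leg23 a (R b c)
    & forall a b c,
        tmap (hphi H b a) (hphi H b c) (R a c) = R (lconj b a) (lconj b c)].
End Quasitriangular.

Record qtHopfPiCoalg := QtHopfPiCoalg {
  qthopf :> crossedHopfPiCoalg;
  hR : forall a b, tensor (qthopf a) (qthopf b);
  hRP : Rmatrix_axiom hR;
}.

(* S_{a^-1} : H_{a^-1} -> H_a *)
Definition hSV (H : hopfPiCoalg) a (x : H a^-1%g) : H a :=
  hcast H (invgK a) (hS H a^-1%g x).

Section Integrals.
Variable H : hopfPiCoalg.

Definition left_pi_integral (lam : forall a, {linear H a -> K^o}) : Prop :=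
  forall a b (x : H (a * b)%g),
    tformr (lam b) (hDelta H a b x) = (lam (a * b)%g x : K) *: aone (H a).

Definition right_pi_integral (lam : forall a, {linear H a -> K^o}) : Prop :=
  forall a b (x : H (a * b)%g),
    tforml (lam a) (hDelta H a b x) = (lam (a * b)%g x : K) *: aone (H b).

Definition pi_grouplike (g : forall a, H a) : Prop :=
  (forall a b, hDelta H a b (g (a * b)%g) = g a ⊗ g b) /\ heps H (g 1%g) = 1.

Definition distinguished_pi_grouplike (g : forall a, H a) : Prop :=
  pi_grouplike g /\
  forall lam, right_pi_integral lam -> forall a b (x : H (a * b)%g),
    tformr (lam b) (hDelta H a b x) = (lam (a * b)%g x : K) *: g a.

Definition left_integral1 (L : H 1%g) : Prop :=
  forall x : H 1%g, x ∙ L = (heps H x : K) *: L.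

Definition distinguished_dual_grouplike (nu : {linear H 1%g -> K^o}) : Prop :=
  multiplicative_unital nu /\
  forall L, left_integral1 L -> forall x : H 1%g, L ∙ x = (nu x : K) *: L.
End Integrals.

Definition crossing_character (H : crossedHopfPiCoalg) (chi : G -> K) : Prop :=
  [/\ forall b, chi b != 0,
      forall b b', chi (b * b')%g = chi b * chi b'
    & forall lam : forall a, {linear H a -> K^o},
        left_pi_integral lam \/ right_pi_integral lam ->
        forall a b (x : H a), lam (lconj b a) (hphi H b a x) = chi b * lam a x].

Section Drinfeld.
Variable H : qtHopfPiCoalg.

Definition drinfeld a : H a :=
  tmulmap (tmap (fun x => hSV (hcast H (lconj_inv a) (hphi H a a^-1%g x))) id
             (tswap (hR H a a^-1%g))).

Definition hell a : H a := ainv (hSV (drinfeld a^-1%g)) ∙ drinfeld a.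
End Drinfeld.
End Hopf.

(* Main.v *)
(* Evaluate a right pi-integral lam on axiom (i) at (a, a^-1), applied to a    *)
(* left integral L of H_1 with lam_1(L) = 1. Moving R out of lam by the two    *)
(* shift identities                                                            *)
(*   x_(1) lam(y x_(2)) = S(y_(1)) g_a lam_1(y_(2) x),                         *)
(*   lam(x_(1) y) x_(2) = lam_1(x y_(1)) S(y_(2)),                             *)
(* axiom (ii) turns the two sides into S(u_{a^-1}) g_a and                     *)
(* phihat(a)^-1 u_a h_a. Here S(u_{a^-1}) = W = sum s S(t) for                 *)
(* R_{a,a^-1} = sum s (x) t, and W is invertible because H_a W is contained in *)
(* W H_a while sum v W S(w) = 1 for R_{a,a^-1}^-1 = sum v (x) w.               *)
(* The integral lam_1 is a trace form, as in the Larson-Sweedler theorem, and  *)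
(* lam_a is determined by lam_1(x_(1)) x_(2) = lam_a(x) 1_a.                   *)

(* Fix [a] and put [b = a^-1]. The heart is [distinguished_drinfeld], which computes one element of
   [H a] in two ways. Choose a right pi-integral [lam] and a left integral [L] of [H 1] with
   [lam 1 L = 1], and apply [id ⊗ lam b] to R-matrix axiom (i) at [(a, b)] evaluated on [L]. The two
   shift lemmas, proved by inserting an antipode pair, move [R] out of [lam]. Axiom (ii) then splits
   [R a b] along [b = b * 1] on one side and along [b = 1 * b] on the other. On the first side the
   extra factor [R a 1] meets [x ∙ L = eps x *: L] and collapses by [R_counit_r]. On the second it
   meets [L ∙ x = nu x *: L] and becomes [h_a], while the crossing in axiom (i) costs the factor
   [(phihat a)^-1]. The result is [S(u_b) g_a = (phihat a)^-1 u_a h_a], and dividing by the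
   invertible [S(u_b)] ([anti_drinfeld_unit]) gives (b). Part (a) is axiom (ii) for [R (a * b) 1]
   followed by [nu]. The crossing occurring there disappears because [nu] is invariant under it
   ([nu_cross]). The pair [lam], [L] must be constructed ([exists_dual_pi_integrals]). A trace
   formula gives a nonzero right integral on [H 1], its nondegeneracy gives [L], and the integral
   spreads to all components because coinvariants of [H a] are scalar. *)
Require Import Defs.
From HB Require Import structures.
From mathcomp Require Import all_boot all_algebra.
From mathcomp Require Import boolp classical_sets.

Set Implicit Arguments.
Unset Strict Implicit.
Unset Printing Implicit Defensive.

Import GRing.Theory VectorInternalTheory.
Local Open Scope ring_scope.

(* The Sweedler sum over X = sum u (x) v. By definition of tlift it is a sum *)
(* over bases, so it is the expected one only when E is bilinear in u and v. *)
Notation "\sw_ ( u , v <- X ) E" := (tlift (fun u v => E) X)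
  (at level 41, E at level 41, u name, v name,
   format "'[' \sw_ ( u ,  v  <-  X ) '/  '  E ']'") : ring_scope.

(** * Linearity side conditions *)

Section Multilinear.
Variable K : fieldType.
Implicit Types U V W : vectType K.

Definition is_lin (U W : lmodType K) (f : U -> W) : Prop :=
  forall c x y, f (c *: x + y) = c *: f x + f y.

Definition linear_of (U W : lmodType K) (f : U -> W) (lf : is_lin f) :
  {linear U -> W} :=
  HB.pack_for {linear U -> W} f (GRing.isLinear.Build K U W _ f lf).

Lemma lin_id (U : lmodType K) : is_lin (fun x : U => x).
Proof. by []. Qed.

Lemma lin_comp (U V W : lmodType K) (f : {linear V -> W}) (g : U -> V) :
  is_lin g -> is_lin (fun x => f (g x)).
Proof. by move=> lg c x y; rewrite lg linearP. Qed.

Lemma lin_compf (U V W : lmodType K) (f : V -> W) (g : U -> V) :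
  is_lin f -> is_lin g -> is_lin (fun x => f (g x)).
Proof. by move=> lf lg c x y; rewrite lg lf. Qed.

Lemma is_linZ (U W : lmodType K) (f : U -> W) c x :
  is_lin f -> f (c *: x) = c *: f x.
Proof. by move=> lf; rewrite -[LHS]/(linear_of lf _) linearZ. Qed.

Lemma is_lin0 (U W : lmodType K) (f : U -> W) : is_lin f -> f 0 = 0.
Proof. by move=> lf; rewrite -[LHS]/(linear_of lf _) linear0. Qed.

Lemma is_linB (U W : lmodType K) (f : U -> W) x y :
  is_lin f -> f (x - y) = f x - f y.
Proof. by move=> lf; rewrite -[LHS]/(linear_of lf _) linearB. Qed.

Lemma lin_scale (U W : lmodType K) (k : K) (g : U -> W) :
  is_lin g -> is_lin (fun x => k *: g x).
Proof. by move=> lg c x y; rewrite lg scalerDr !scalerA mulrC. Qed.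

Lemma lin_scalel (U W : lmodType K) (g : U -> K^o) (w : W) :
  is_lin g -> is_lin (fun x => (g x : K) *: w).
Proof. by move=> lg c x y; rewrite lg scalerDl scalerA. Qed.

Lemma lin_mull (U : lmodType K) (A : fdAlgType K) (a : A) (g : U -> A) :
  is_lin g -> is_lin (fun x => a ∙ g x).
Proof. by move=> lg c x y; rewrite lg (proj1 (@amul_bilin K A)). Qed.

Lemma lin_mulr (U : lmodType K) (A : fdAlgType K) (a : A) (g : U -> A) :
  is_lin g -> is_lin (fun x => g x ∙ a).
Proof.
by move=> lg c x y; rewrite lg [LHS](proj2 (@amul_bilin K A) a).
Qed.

Lemma lin_tensl (T : lmodType K) U V (v : V) (g : T -> U) :
  is_lin g -> is_lin (fun x => g x ⊗ v).
Proof.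
by move=> lg c x y; rewrite lg [LHS](proj2 (@tens_bilinear K U V) v).
Qed.

Lemma lin_tensr (T : lmodType K) U V (u : U) (g : T -> V) :
  is_lin g -> is_lin (fun x => u ⊗ g x).
Proof. by move=> lg c x y; rewrite lg (proj1 (@tens_bilinear K U V)). Qed.

Lemma lin_tlift (T : lmodType K) U V W (F : U -> V -> W) (g : T -> tensor U V) :
  is_lin g -> is_lin (fun x => tlift F (g x)).
Proof. by move=> lg c x y; rewrite lg linearP. Qed.

Lemma lin_tlift_body (T : lmodType K) U V W (F : T -> U -> V -> W)
    (X : tensor U V) :
  (forall u v, is_lin (fun x => F x u v)) -> is_lin (fun x => tlift (F x) X).
Proof. by move=> lF c x y; apply: tlift_combl => u v; apply: lF. Qed.

Lemma lin_sum (I : Type) (r : seq I) (P : pred I) (U W : lmodType K)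
    (F : I -> U -> W) :
  (forall i, is_lin (F i)) -> is_lin (fun x => \sum_(i <- r | P i) F i x).
Proof.
move=> lF c x y; rewrite scaler_sumr -big_split; apply: eq_bigr => i _.
exact: lF.
Qed.

Lemma bilinP U V W (F : U -> V -> W) :
  (forall v, is_lin (fun u => F u v)) -> (forall u, is_lin (F u)) -> bilin F.
Proof. by move=> Fl Fr; split=> [u|v] c x y; [apply: Fr | apply: Fl]. Qed.

Lemma bilin_linl U V W (F : U -> V -> W) (bF : bilin F) v :
  is_lin (fun u => F u v).
Proof. by case: bF => _ lF c x y; apply: lF. Qed.

Lemma bilin_linr U V W (F : U -> V -> W) (bF : bilin F) u :
  is_lin (F u).
Proof. by case: bF => lF _ c x y; apply: lF. Qed.

Definition trilin (U V W X : vectType K) (F : U -> V -> W -> X) : Prop :=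
  [/\ forall v w, is_lin (fun u => F u v w),
      forall u w, is_lin (fun v => F u v w)
    & forall u v, is_lin (fun w => F u v w)].
End Multilinear.

(** Structural recursion on the expression. Most regroupings of a Sweedler sum carry such a side
    condition, since [tlift] only depends on its tensor in the expected way when the body is
    bilinear. *)
Ltac multilinear :=
  lazymatch goal with
  | |- bilin _ => apply: bilinP => ?; multilinear
  | |- trilin _ => split=> ? ?; multilinear
  | |- is_lin _ => cbv beta; first
      [ apply: lin_id
      | solve [match goal with h : _ |- _ => apply: h end]
      | apply: lin_tlift_body => ? ?; multilinear
      | apply: lin_tlift; multilinear
      | apply: lin_mull; multilinear
      | apply: lin_mulr; multilinear
      | apply: lin_tensl; multilinear
      | apply: lin_tensr; multilinear
      | apply: lin_scalel; multilinear
      | apply: lin_scale; multilinear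
      | apply: lin_sum => ?; multilinear
      | apply: lin_comp; multilinear
      | match goal with h : is_lin _ |- _ =>
          apply: (lin_compf h); multilinear end
      | match goal with h : forall _ _, is_lin _ |- _ =>
          apply: (lin_compf (h _ _)); multilinear end
      | match goal with h : bilin _ |- _ => first
          [ apply: (lin_compf (bilin_linl h _)); multilinear
          | apply: (lin_compf (bilin_linr h _)); multilinear ] end ]
  end.

(** * Calculus of Sweedler sums *)

Section Sweedler.
Variable K : fieldType.
Implicit Types U V W : vectType K.

Lemma eq_tlift U V W (F F' : U -> V -> W) (x : tensor U V) :
  (forall u v, F u v = F' u v) -> tlift F x = tlift F' x.
Proof.
by move=> eF; apply: eq_bigr => i _; apply: eq_bigr => j _; rewrite eF.
Qed.

Lemma tlift_lin U V W W' (f : W -> W') (F : U -> V -> W) (x : tensor U V) :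
  is_lin f -> f (tlift F x) = \sw_(u, v <- x) f (F u v).
Proof.
move=> lf; rewrite -[LHS]/(linear_of lf _) linear_sum; apply: eq_bigr => i _.
by rewrite linear_sum; apply: eq_bigr => j _; rewrite linearZ.
Qed.

Lemma tlift_tlift U V U' V' W (F : U' -> V' -> W) (G : U -> V -> tensor U' V')
    (x : tensor U V) :
  tlift F (tlift G x) = \sw_(u, v <- x) tlift F (G u v).
Proof. by apply: tlift_lin; multilinear. Qed.

Lemma tlift_id U V (x : tensor U V) : \sw_(u, v <- x) (u ⊗ v) = x.
Proof. by rewrite [RHS]tens_sum. Qed.

Lemma tlift_exch U V U' V' W (F : U -> V -> U' -> V' -> W)
    (x : tensor U V) (y : tensor U' V') :
  \sw_(u, v <- x) \sw_(u', v' <- y) F u v u' v' =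
  \sw_(u', v' <- y) \sw_(u, v <- x) F u v u' v'.
Proof.
rewrite /tlift; under eq_bigr => i _.
  under eq_bigr => j _.
    rewrite scaler_sumr; under eq_bigr => k _ do rewrite scaler_sumr.
    over.
  rewrite exchange_big /=; under eq_bigr => k _ do rewrite exchange_big.
  over.
rewrite exchange_big; apply: eq_bigr => k _ /=; rewrite exchange_big /=.
apply: eq_bigr => l _; rewrite scaler_sumr; apply: eq_bigr => i _.
rewrite !scaler_sumr; apply: eq_bigr => j _.
by rewrite !scalerA mulrC.
Qed.

Lemma tlift_sum (I : Type) (r : seq I) U V W (F : I -> U -> V -> W)
    (x : tensor U V) :
  \sw_(u, v <- x) \sum_(i <- r) F i u v = \sum_(i <- r) \sw_(u, v <- x) F i u v.
Proof.
rewrite /tlift [RHS]exchange_big; apply: eq_bigr => i _ /=.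
rewrite [RHS]exchange_big; apply: eq_bigr => j _ /=.
by rewrite scaler_sumr.
Qed.

Lemma tlift_mul (A B : fdAlgType K) W (F : A -> B -> W) (x y : tensor A B) :
  bilin F ->
  tlift F (x ∙ y) =
  \sw_(u, v <- x) \sw_(u', v' <- y) F (u ∙ u') (v ∙ v').
Proof.
move=> bF; rewrite -[x ∙ y]/(talg_mul x y) /talg_mul tlift_tlift.
apply: eq_tlift => u v; rewrite tlift_tlift; apply: eq_tlift => u' v'.
exact: tliftE.
Qed.

Lemma tlift_tmap U V U' V' W (f : U -> U') (g : V -> V') (F : U' -> V' -> W)
    (x : tensor U V) :
  bilin F -> tlift F (tmap f g x) = \sw_(u, v <- x) F (f u) (g v).
Proof.
by move=> bF; rewrite tlift_tlift; apply: eq_tlift => u v; apply: tliftE.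
Qed.

Lemma tlift_tswap U V W (F : V -> U -> W) (x : tensor U V) :
  bilin F -> tlift F (tswap x) = \sw_(u, v <- x) F v u.
Proof.
by move=> bF; rewrite tlift_tlift; apply: eq_tlift => u v; apply: tliftE.
Qed.
End Sweedler.

(** * Hopf group-coalgebras *)

Section PiCoalgebra.
Variables (K : fieldType) (G : groupType) (H : hopfPiCoalg K G).
Implicit Types (a b c d : G) (W : vectType K).
Local Notation eps := (heps H).
Local Notation cast e := (icast (fun a => hcar H a) e).

(* Indexing by a proof of c = a * b removes all transports from Sweedler *)
(* computations: equalities in G are proof-irrelevant.                   *)
Definition copr a b c (e : c = (a * b)%g) :
  {linear H c -> tensor (H a) (H b)} :=
  linear_of (lin_comp (hDelta H a b) (lin_comp (cast e) (@lin_id K (H c)))).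

Definition anti a b (e : b = a^-1%g) : {linear H a -> H b} :=
  linear_of (lin_comp (cast (esym e)) (lin_comp (hS H a) (@lin_id K (H a)))).

Lemma icast_irr a b (e e' : a = b) (x : H a) : cast e x = cast e' x.
Proof. by rewrite (eq_irrelevance e e'). Qed.

Lemma copr_coassoc W a b c ab bc d (e1 : ab = (a * b)%g) (e2 : d = (ab * c)%g)
    (e3 : bc = (b * c)%g) (e4 : d = (a * bc)%g) (F : H a -> H b -> H c -> W)
    (x : H d) : trilin F ->
  \sw_(u, w <- copr e2 x) \sw_(u1, u2 <- copr e1 u) F u1 u2 w =
  \sw_(u, v <- copr e4 x) \sw_(v1, v2 <- copr e3 v) F u v1 v2.
Proof.
move=> [F1 F2 F3]; have [coas _ _] := hcoalgP H.
subst ab bc d; rewrite /copr /= (icast_irr e4 (esym (mulgA a b c))).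
have {coas} := coas a b c x.
move/(congr1 (fun y => \sw_(u, z <- y) \sw_(v, w <- z) F u v w)).
rewrite [X in _ = X -> _]tlift_tmap /=; last by multilinear.
rewrite (tlift_tlift _ _ (tmap _ _ _)) tlift_tmap; last by multilinear.
move=> <-; apply: eq_tlift => u w.
rewrite tlift_tlift; apply: eq_tlift => u1 u2.
by rewrite !tliftE //; multilinear.
Qed.

Lemma copr_counitr W a (e : a = (a * 1)%g) (F : H a -> W) (x : H a) :
  is_lin F -> \sw_(u, v <- copr e x) (eps v : K) *: F u = F x.
Proof.
move=> lF; have [_ cr _] := hcoalgP H.
rewrite -[in RHS](cr a x) /tformr (tlift_lin _ _ lF) /= /copr /=.
rewrite (icast_irr e (esym (mulg1 a))).
by apply: eq_tlift => u v; rewrite is_linZ.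
Qed.

Lemma copr_counitl W a (e : a = (1 * a)%g) (F : H a -> W) (x : H a) :
  is_lin F -> \sw_(u, v <- copr e x) (eps u : K) *: F v = F x.
Proof.
move=> lF; have [_ _ cl] := hcoalgP H.
rewrite -[in RHS](cl a x) /tforml (tlift_lin _ _ lF) /= /copr /=.
rewrite (icast_irr e (esym (mul1g a))).
by apply: eq_tlift => u v; rewrite is_linZ.
Qed.

Lemma copr_one a b c (e : c = (a * b)%g) :
  copr e (aone (H c)) = aone (H a) ⊗ aone (H b).
Proof. by subst c; case: (hDelta_alg H a b). Qed.

Lemma copr_mul a b c (e : c = (a * b)%g) (x y : H c) :
  copr e (x ∙ y) = copr e x ∙ copr e y.
Proof. by subst c; case: (hDelta_alg H a b) => _; apply. Qed.

Lemma tlift_copr_mul W a b c (e : c = (a * b)%g) (F : H a -> H b -> W)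
    (x y : H c) : bilin F ->
  tlift F (copr e (x ∙ y)) =
  \sw_(u, v <- copr e x) \sw_(u', v' <- copr e y) F (u ∙ u') (v ∙ v').
Proof. by move=> bF; rewrite copr_mul tlift_mul. Qed.

Lemma heps_one : eps (aone (H 1%g)) = 1 :> K.
Proof. by case: (heps_alg H). Qed.

Lemma heps_mul (x y : H 1%g) : eps (x ∙ y) = eps x * eps y :> K.
Proof. by case: (heps_alg H) => _; apply. Qed.

Lemma hcar1_neq0 : aone (H 1%g) != 0.
Proof.
apply/eqP => e; have := heps_one; rewrite e linear0 => /esym /eqP.
by rewrite oner_eq0.
Qed.

Lemma antil W a b (e : 1%g = (b * a)%g) (eb : a = b^-1%g)
    (F : H a -> W) (x : H 1%g) : is_lin F ->
  \sw_(u, v <- copr e x) F (anti eb u ∙ v) = (eps x : K) *: F (aone (H a)).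
Proof.
move=> lF; have eb' : b = a^-1%g by rewrite eb invgK.
subst b; have [+ _] := @hSP K G H a x; rewrite /tmulmap tlift_tmap //.
  move/(congr1 F); rewrite (tlift_lin _ _ lF) is_linZ // => <-.
  rewrite /copr /= (icast_irr e (esym (mulVg a))); apply: eq_tlift => u v.
  by rewrite /anti /= (icast_irr (esym eb) (invgK a)).
exact: amul_bilin.
Qed.

Lemma antir W a b (e : 1%g = (a * b)%g) (eb : a = b^-1%g)
    (F : H a -> W) (x : H 1%g) : is_lin F ->
  \sw_(u, v <- copr e x) F (u ∙ anti eb v) = (eps x : K) *: F (aone (H a)).
Proof.
move=> lF; have eb' : b = a^-1%g by rewrite eb invgK.
subst b; have [_ +] := @hSP K G H a x; rewrite /tmulmap tlift_tmap //.
  move/(congr1 F); rewrite (tlift_lin _ _ lF) is_linZ // => <-.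
  rewrite /copr /= (icast_irr e (esym (mulgV a))); apply: eq_tlift => u v.
  by rewrite /anti /= (icast_irr (esym eb) (invgK a)).
exact: amul_bilin.
Qed.

Lemma anti_one a b (eb : a = b^-1%g) : anti eb (aone (H b)) = aone (H a).
Proof.
have e : 1%g = (b * a)%g by rewrite eb mulgV.
have := antil e eb (aone (H 1%g)) (@lin_id K (H a)).
rewrite copr_one tliftE; last by multilinear.
by rewrite amul1r heps_one scale1r.
Qed.

(** Uniqueness of convolution inverses: evaluate the sum of S(x1 y1) x2 y2 S(y3) S(x3) by cancelling
    either the first two factors or the last two. *)
Lemma anti_mul a b (eb : a = b^-1%g) (x y : H b) :
  anti eb (x ∙ y) = anti eb y ∙ anti eb x.
Proof.
have e1 : 1%g = (b * a)%g by rewrite eb mulgV.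
have e2 : 1%g = (a * b)%g by rewrite eb mulVg.
have e3 : b = (1 * b)%g by rewrite mul1g.
have e4 : b = (b * 1)%g by rewrite mulg1.
transitivity (\sw_(x1, x2 <- copr e3 x) \sw_(y1, y2 <- copr e3 y)
  \sw_(p, q <- copr e1 (x1 ∙ y1)) (anti eb p ∙ q ∙ (anti eb y2 ∙ anti eb x2)));
  last first.
  under eq_tlift => x1 x2.
    under eq_tlift => y1 y2.
      rewrite (antil _ _ _ (lin_mulr _ (@lin_id K (H a)))) amul1l.
      by rewrite heps_mul -scalerA; over.
    rewrite -(tlift_lin (f := fun z => (eps x1 : K) *: z)); last by multilinear.
    rewrite (copr_counitl _ (F := fun y2 => anti eb y2 ∙ anti eb x2));
      last by multilinear.
    over.
  by rewrite (copr_counitl _ (F := fun x2 => anti eb y ∙ anti eb x2));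
    last by multilinear.
symmetry; under eq_tlift => x1 x2.
  under eq_tlift => y1 y2.
    rewrite tlift_copr_mul; last by multilinear.
    over.
  rewrite tlift_exch; over.
rewrite (copr_coassoc _ _ e2 e4 (F := fun p q x2 => \sw_(y1, y2 <- copr e3 y)
  \sw_(p', q' <- copr e1 y1)
    (anti eb (p ∙ p') ∙ (q ∙ q') ∙ (anti eb y2 ∙ anti eb x2))));
  last by multilinear.
under eq_tlift => p z.
  under eq_tlift => q x2.
    rewrite (copr_coassoc _ _ e2 e4 (F := fun p' q' y2 =>
      (anti eb (p ∙ p') ∙ (q ∙ q') ∙ (anti eb y2 ∙ anti eb x2))));
      last by multilinear.
    under eq_tlift => p' z'.
      under eq_tlift => q' y2.
        rewrite -!amulA [q' ∙ _]amulA.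
        over.
      rewrite (antir _ _ _ (F := fun w =>
        anti eb (p ∙ p') ∙ (q ∙ (w ∙ anti eb x2))));
        last by multilinear.
      rewrite amul1l; over.
    rewrite (copr_counitr _ (F := fun p' => anti eb (p ∙ p') ∙ (q ∙ anti eb x2)));
      last by multilinear.
    over.
  rewrite (antir _ _ _ (F := fun w => anti eb (p ∙ y) ∙ w));
    last by multilinear.
  rewrite amul1r; over.
by rewrite (copr_counitr _ (F := fun p => anti eb (p ∙ y)));
  last by multilinear.
Qed.

Section AntipodeComultiplication.
Variables (e : 1%g = (1 * 1)%g :> G) (e1 : 1%g = (1^-1)%g :> G).
Local Notation A := (H 1%g).
Local Notation D := (copr e).
Local Notation S := (anti e1).

(** The flipped [(S ⊗ S) D] is a right convolution inverse of [D]. Coassociativity brings the inner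
    pair together, where it cancels before the outer one. *)
Let comul_anti_inv (z : A) :
  \sw_(v, x <- D z) (D v ∙ \sw_(p, q <- D x) (S q ⊗ S p)) =
  (eps z : K) *: (aone A ⊗ aone A).
Proof.
transitivity (\sw_(v, x <- D z) \sw_(v1, v2 <- D v) \sw_(p, q <- D x)
   ((v1 ∙ S q) ⊗ (v2 ∙ S p))).
  apply: eq_tlift => v x; rewrite -{1}(tlift_id (D v)).
  rewrite (tlift_lin (f := fun Y => Y ∙ _)); last by multilinear.
  apply: eq_tlift => v1 v2; rewrite tlift_lin; last by multilinear.
  by apply: eq_tlift => p q; rewrite tens_mulE.
rewrite (copr_coassoc _ _ e e (F := fun v1 v2 x => \sw_(p, q <- D x)
   ((v1 ∙ S q) ⊗ (v2 ∙ S p)))); last by multilinear.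
under eq_tlift => v1 w.
  rewrite -(copr_coassoc e e _ _ (F := fun v2 p q =>
    ((v1 ∙ S q) ⊗ (v2 ∙ S p)))); last by multilinear.
  under eq_tlift => t q.
    rewrite (antir _ _ _ (F := fun y => (v1 ∙ S q) ⊗ y)); last by multilinear.
    over.
  rewrite (copr_counitl _ (F := fun q => (v1 ∙ S q) ⊗ aone A));
    last by multilinear.
  over.
by rewrite (antir _ _ _ (F := fun y => y ⊗ aone A)); last by multilinear.
Qed.

(** [D \o S] is a left convolution inverse of [D] since [D] is multiplicative, so it agrees with the
    right inverse of [comul_anti_inv]. *)
Lemma anti_comul (x : A) : D (S x) = \sw_(x1, x2 <- D x) (S x2 ⊗ S x1).
Proof.
symmetry.
rewrite -(copr_counitl e (F := fun x => \sw_(x1, x2 <- D x) (S x2 ⊗ S x1)));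
  last by multilinear.
transitivity (\sw_(x1, x2 <- D x) \sw_(u, v <- D x1)
    (D (S u) ∙ (D v ∙ \sw_(p, q <- D x2) (S q ⊗ S p)))).
  apply: eq_tlift => x1 x2.
  under [RHS]eq_tlift => u v do rewrite amulA -copr_mul.
  rewrite (antil _ _ _ (F := fun y => D y ∙ _)); last by multilinear.
  by rewrite copr_one amul1l.
rewrite (copr_coassoc _ _ e e (F := fun u v x2 =>
    (D (S u) ∙ (D v ∙ \sw_(p, q <- D x2) (S q ⊗ S p))))); last by multilinear.
under eq_tlift => u z.
  rewrite -(tlift_lin (f := fun y => D (S u) ∙ y)); last by multilinear.
  rewrite comul_anti_inv is_linZ; last by multilinear.
  rewrite amul1r; over.
by rewrite (copr_counitr _ (F := fun u => D (S u))); last by multilinear.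
Qed.
End AntipodeComultiplication.
End PiCoalgebra.
Arguments copr {K G H a b c} e.
Arguments anti {K G H a b} e.

(** * Integrals of the neutral component *)

Section FiniteDimension.
Variable K : fieldType.
Implicit Types U V W : vectType K.

Let coor_is_lin U (i : 'I_(dim U)) : is_lin (fun x : U => v2r x 0 i : K^o).
Proof. by move=> c x y; rewrite linearP !mxE. Qed.

Definition coor U (i : 'I_(dim U)) : {linear U -> K^o} :=
  linear_of (@coor_is_lin U i).

Lemma coor_sum U W (f : U -> W) (x : U) : is_lin f ->
  f x = \sum_i (coor i x : K) *: f (vbase i).
Proof.
move=> lf; rewrite {1}(vbase_sum x) -[LHS]/(linear_of lf _) linear_sum.
by apply: eq_bigr => i _; rewrite linearZ.
Qed.

Lemma trace_comm U V (f : U -> V) (g : V -> U) : is_lin f -> is_lin g ->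
  \sum_i coor i (g (f (vbase i))) = \sum_i coor i (f (g (vbase i))).
Proof.
move=> lf lg.
under eq_bigr => i _.
  rewrite (coor_sum (f := fun y => coor i (g y))); last by multilinear.
  over.
rewrite exchange_big; apply: eq_bigr => j _ /=.
rewrite [RHS](coor_sum (f := fun y => coor j (f y))); last by multilinear.
by apply: eq_bigr => i _; rewrite [LHS]mulrC.
Qed.

Lemma inj_lin_surj U (f : U -> U) : is_lin f -> (forall x, f x = 0 -> x = 0) ->
  forall y, exists x, f x = y.
Proof.
move=> lf f0; pose g := linfun (linear_of lf).
have g0 : lker g == 0%VS.
  apply/lker0P => x y; rewrite !lfunE => exy; apply/eqP; rewrite -subr_eq0.
  by apply/eqP/f0; rewrite is_linB //; apply/eqP; rewrite subr_eq0; apply/eqP.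
by move=> y; exists (g^-1%VF y); have := lker0_lfunVK g0 y; rewrite lfunE.
Qed.

Section Nondegenerate.
Variables (U : vectType K) (B : U -> U -> K^o).
Hypotheses (Bbilin : bilin B)
  (B_nd : forall u, (forall v, B u v = 0) -> u = 0).
Let M := \matrix_(i, j) (B (vbase i) (vbase j) : K).

(** A row vector killed by the Gram matrix is a vector in the left radical of [B]. Invertibility
    then yields both representability of forms and nondegeneracy on the right. *)
Let M_unit : M \in unitmx.
Proof.
have [Br Bl] := Bbilin.
rewrite -row_free_unit; apply: inj_row_free => v vM.
suff /(congr1 v2r) : r2v v = 0 by rewrite r2vK linear0.
apply: B_nd => w; rewrite (coor_sum _ (Br _)) big1 // => j _.
have -> : B (r2v v) (vbase j) = 0; last by rewrite scaler0.
rewrite (coor_sum _ (Bl _)); move/matrixP/(_ 0 j): vM; rewrite !mxE => vM.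
by rewrite -[RHS]vM; apply: eq_bigr => i _; rewrite /coor /= r2vK mxE.
Qed.

Let M_mulE (v : U) i : (M *m (v2r v)^T) i 0 = B (vbase i) v.
Proof.
have [Br _] := Bbilin; rewrite mxE [RHS](coor_sum _ (Br _)).
by apply: eq_bigr => j _; rewrite [M i j]mxE [X in _ * X]mxE mulrC.
Qed.

Lemma left_nondegenerate_repr (psi : {linear U -> K^o}) :
  exists v, forall u, B u v = psi u.
Proof.
have [_ Bl] := Bbilin; pose c := invmx M *m \col_i (psi (vbase i) : K).
exists (r2v c^T) => u; rewrite (coor_sum _ (Bl _)).
rewrite [RHS](coor_sum (f := psi) u); last by multilinear.
apply: eq_bigr => i _; congr (_ *: _).
by rewrite -[LHS]M_mulE r2vK trmxK mulKVmx // mxE.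
Qed.

Lemma left_nondegenerate_right (v : U) : (forall u, B u v = 0) -> v = 0.
Proof.
move=> Bv0; apply: (can_inj v2rK); rewrite linear0; apply: trmx_inj.
rewrite -[LHS](mulKmx M_unit).
suff -> : M *m (v2r v)^T = 0 by rewrite mulmx0 trmx0.
by apply/matrixP => i j; rewrite ord1 M_mulE Bv0 mxE.
Qed.
End Nondegenerate.
End FiniteDimension.

(** * The Larson-Sweedler theorem for [H 1] *)

Section Integrals.
Variables (K : fieldType) (G : groupType) (H : hopfPiCoalg K G).
Variables (e : 1%g = (1 * 1)%g :> G) (e1 : 1%g = (1^-1)%g :> G).
Local Notation eps := (heps H).
Local Notation A := (H 1%g).
Local Notation D := (copr (H := H) e).
Local Notation S := (anti (H := H) e1).

Lemma heps_anti (x : A) : eps (S x) = eps x.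
Proof.
have := antil e e1 x (F := eps) (lin_comp _ (@lin_id _ _)).
rewrite heps_one; under eq_tlift => u v do rewrite heps_mul mulrC.
rewrite (copr_counitr _ (F := fun u => eps (S u))); last by multilinear.
by move=> ->; rewrite -[LHS]/((eps x : K) * 1) mulr1.
Qed.

Let contrl_is_lin (f : A -> K^o) : is_lin (fun z => tforml f (D z)).
Proof. by rewrite /tforml; multilinear. Qed.

(** The hit action of the dual on [A]. A form [f] is a right integral exactly when this operator
    sends each [z] to [f z] times the unit. *)
Definition contrl (f : A -> K^o) : {linear A -> A} := linear_of (contrl_is_lin f).

Lemma contrlE f z : contrl f z = \sw_(z1, z2 <- D z) (f z1 : K) *: z2.
Proof. by []. Qed.

Lemma copr_contrl (W : vectType K) (f : A -> K^o) (B : A -> A -> W) (z : A) :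
  is_lin f -> bilin B ->
  tlift B (D (contrl f z)) = \sw_(z1, z2 <- D z) B (contrl f z1) z2.
Proof.
move=> lf [Br Bl]; rewrite contrlE.
rewrite (tlift_lin (f := fun y => tlift B (D y))); last by multilinear.
under eq_tlift => u v.
  rewrite (is_linZ (f := fun y => tlift B (D y))); last by multilinear.
  rewrite (tlift_lin (f := fun y => (f u : K) *: y)); last by multilinear.
  over.
rewrite -(copr_coassoc e e _ _ (F := fun u v w => (f u : K) *: B v w)); last first.
  split=> u v; [multilinear | apply: lin_scale | apply: lin_scale].
    exact: Bl.
  exact: Br.
apply: eq_tlift => u w.
rewrite (tlift_lin (f := fun y => B y w)) => [|? ? ?]; last exact: Bl.
by apply: eq_tlift => v1 v2; rewrite (is_linZ (f := B^~ w)) //; apply: Bl.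
Qed.

(** The coproduct of S(h2) is S(h3) ⊗ S(h2), after which h1 S(h2) cancels. *)
Lemma contrl_antil (f : A -> K^o) (h x : A) : is_lin f ->
  \sw_(x1, x2 <- D x) (f (S h ∙ x1) : K) *: x2 =
  \sw_(h1, h2 <- D h) (h1 ∙ contrl f (S h2 ∙ x)).
Proof.
move=> lf; symmetry.
under eq_tlift => h1 h2.
  rewrite contrlE.
  rewrite tlift_copr_mul ?anti_comul ?tlift_tlift; last by multilinear.
  under eq_tlift => p q.
    rewrite tliftE; last by multilinear.
    over.
  rewrite (tlift_lin (f := fun y => h1 ∙ y)); last by multilinear.
  over.
rewrite -(copr_coassoc e e _ _ (F := fun h1 p q => h1 ∙ \sw_(x1, x2 <- D x)
  ((f (S q ∙ x1) : K) *: (S p ∙ x2)))); last by multilinear.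
under eq_tlift => u q.
  under eq_tlift => h1 p.
    rewrite tlift_lin; last by multilinear.
    under eq_tlift => x1 x2.
      rewrite (is_linZ (f := fun y => h1 ∙ y)); last by multilinear.
      rewrite amulA; over.
    over.
  rewrite (antir _ _ _ (F := fun y => \sw_(x1, x2 <- D x)
    ((f (S q ∙ x1) : K) *: (y ∙ x2)))); last by multilinear.
  under eq_tlift => x1 x2 do rewrite amul1l.
  over.
by rewrite (copr_counitl _ (F := fun q => \sw_(x1, x2 <- D x)
  ((f (S q ∙ x1) : K) *: x2))); last by multilinear.
Qed.

(* The Larson-Sweedler projection of the dual of A, a Hopf module over A, *)
(* onto its coinvariants, which are the right integrals.                  *)
Definition trace_form (f : A -> K^o) (x : A) : K^o :=
  \sum_i coor i (contrl f (S (S (vbase i)) ∙ x)).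

Lemma trace_form_lin f : is_lin (trace_form f).
Proof. by rewrite /trace_form; multilinear. Qed.

(** [trace_form f x] is the trace of [contrl f \o Z]. After [contrl_antil], summing over the basis
    index moves [contrl f] inside a coproduct, where an antipode pair cancels. What remains is the
    trace of [Z \o contrl f], and the trace is cyclic. *)
Lemma trace_form_integral (f : A -> K^o) (x : A) : is_lin f ->
  \sw_(x1, x2 <- D x) (trace_form f x1 : K) *: x2 =
  (trace_form f x : K) *: aone A.
Proof.
move=> lf; pose Z p : A := S (S p) ∙ x.
transitivity (\sum_i \sw_(p, q <- D (vbase i)) \sum_m (coor m (Z p) : K) *:
    (S q ∙ \sw_(z1, z2 <- D (vbase m)) (coor i (contrl f z1) : K) *: z2)).
  under eq_tlift => x1 x2 do rewrite scaler_suml.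
  rewrite tlift_sum; apply: eq_bigr => i _.
  rewrite (contrl_antil (f := fun z => coor i (contrl f z)));
    last by multilinear.
  rewrite anti_comul tlift_tlift; apply: eq_tlift => p q.
  rewrite tliftE; last by multilinear.
  by rewrite (coor_sum (f := fun z => S q ∙ contrl _ z)); last by multilinear.
transitivity (\sum_m \sw_(z1, z2 <- D (vbase m)) \sw_(p, q <- D (contrl f z1))
    ((coor m (Z p) : K) *: (S q ∙ z2))).
  under eq_bigr => i _ do rewrite tlift_sum.
  rewrite exchange_big; apply: eq_bigr => m _ /=.
  under [RHS]eq_tlift => z1 z2.
    rewrite (coor_sum (f := fun y => \sw_(p, q <- D y)
      ((coor m (Z p) : K) *: (S q ∙ z2)))); last by multilinear.
    over.
  rewrite tlift_sum; apply: eq_bigr => i _.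
  under [RHS]eq_tlift => z1 z2.
    rewrite (tlift_lin (f := fun y => (coor i (contrl f z1) : K) *: y));
      last by multilinear.
    over.
  rewrite tlift_exch; apply: eq_tlift => p q.
  rewrite tlift_lin; last by multilinear.
  rewrite tlift_lin; last by multilinear.
  apply: eq_tlift => z1 z2.
  rewrite (is_linZ (f := fun y => S q ∙ y)); last by multilinear.
  by rewrite !scalerA mulrC.
transitivity (\sum_m (coor m (Z (contrl f (vbase m))) : K) *: aone A).
  apply: eq_bigr => m _.
  rewrite -(copr_contrl (B := fun y z => \sw_(p, q <- D y)
    ((coor m (Z p) : K) *: (S q ∙ z)))) //; last by rewrite /Z; multilinear.
  rewrite (copr_coassoc e e e e (F := fun p q z =>
    (coor m (Z p) : K) *: (S q ∙ z))); last by rewrite /Z; multilinear.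
  under eq_tlift => p z.
    rewrite (antil _ _ _ (F := fun y => (coor m (Z p) : K) *: y));
      last by multilinear.
    over.
  by rewrite (copr_counitr _ (F := fun p => (coor m (Z p) : K) *: aone A));
    last by rewrite /Z; multilinear.
rewrite -scaler_suml; congr (_ *: _).
by apply: (trace_comm (f := contrl f) (g := Z)); rewrite /Z; multilinear.
Qed.

(** Every form is a sum of translates of right integrals, the generation half of the Hopf module
    theorem. With [y = contrl f (vbase m)], inserting y1 S(y2) = eps(y) 1 into the coordinate
    expansion of [f x] produces S(e_i S(e_j)) = S(S(e_j)) S(e_i), whose sum over [j] is a trace. *)
Lemma trace_form_span (f : A -> K^o) (x : A) : is_lin f ->
  f x = \sum_i trace_form (fun z => coor i (contrl f z)) (S (vbase i) ∙ x).
Proof.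
move=> lf.
transitivity (\sum_m \sw_(z1, z2 <- D (vbase m))
    coor m (S (contrl f z1 ∙ S z2) ∙ x)).
  rewrite (coor_sum x lf); apply: eq_bigr => m _.
  rewrite -(copr_contrl (B := fun y z => coor m (S (y ∙ S z) ∙ x))) //;
    last by multilinear.
  rewrite (antir _ _ _ (F := fun y => coor m (S y ∙ x))); last by multilinear.
  rewrite anti_one amul1l contrlE tlift_lin; last by multilinear.
  under eq_tlift => u v.
    rewrite is_linZ; last by multilinear.
    rewrite [_ *: _]mulrC; over.
  by rewrite (copr_counitr _ (F := f)) // [LHS]mulrC.
have expand m z1 z2 : coor m (S (contrl f z1 ∙ S z2) ∙ x) =
    \sum_i \sum_j (coor i (contrl f z1) : K) *: ((coor j z2 : K) *:
      coor m (S (vbase i ∙ S (vbase j)) ∙ x)).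
  rewrite (coor_sum (f := fun y => coor m (S (y ∙ S z2) ∙ x)));
    last by multilinear.
  apply: eq_bigr => i _.
  rewrite (coor_sum (f := fun z => coor m (S (vbase i ∙ S z) ∙ x)));
    last by multilinear.
  by rewrite scaler_sumr.
under eq_bigr => m _.
  under eq_tlift => z1 z2 do rewrite expand.
  rewrite tlift_sum; over.
rewrite exchange_big; apply: eq_bigr => i _; cbv beta; rewrite /trace_form.
under eq_bigr => m _ do rewrite tlift_sum.
rewrite exchange_big; apply: eq_bigr => j _; cbv beta.
rewrite (coor_sum (f := fun y => coor j (contrl _ y))); last by multilinear.
apply: eq_bigr => m _.
rewrite [X in _ = _ *: coor j X]contrlE.
rewrite (tlift_lin (f := coor j)); last by multilinear.
rewrite tlift_lin; last by multilinear.
apply: eq_tlift => z1 z2; rewrite anti_mul amulA.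
rewrite (is_linZ (f := coor j)); last by multilinear.
by rewrite scalerA [LHS]mulrC.
Qed.

Lemma exists_right_integral : exists2 f : {linear A -> K^o},
  forall x, \sw_(x1, x2 <- D x) (f x1 : K) *: x2 = (f x : K) *: aone A
  & exists x, f x != 0.
Proof.
(* If all these trace forms vanished, [trace_form_span] would make [eps] vanish, against
   [eps 1 = 1]. *)
have [i [x nz]] : exists i x,
    trace_form (fun z => coor i (contrl eps z)) x != 0.
  apply: contrapT => /forallNP nz.
  have := heps_one H; rewrite (trace_form_span (f := eps)); last by multilinear.
  rewrite big1 => [/esym/eqP|i _]; first by rewrite oner_eq0.
  by have /forallNP/(_ (S (vbase i) ∙ aone A))/negP/negPn/eqP := nz i.
exists (linear_of (@trace_form_lin (fun z => coor i (contrl eps z)))).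
  by move=> y; apply: trace_form_integral; multilinear.
by exists x.
Qed.

(** By [contrl_antil] and integrality, the hypothesis gives that f(S(h2) y) h1 sums to 0 for every
    y. On the other hand f(x) h is the sum of f(S(h3) S(S(h2)) x) h1, since S(h3) S(S(h2)) = S(S(h2)
    h3). Expanding S(S(h2)) x in a basis reduces this to the vanishing sums. *)
Lemma integral_anti_inj (f : {linear A -> K^o}) (h : A) :
  (forall x, \sw_(x1, x2 <- D x) (f x1 : K) *: x2 = (f x : K) *: aone A) ->
  (exists x, f x != 0) -> (forall x, f (S h ∙ x) = 0) -> h = 0.
Proof.
move=> fint [x fx] fh0.
have h0 y : \sw_(h1, h2 <- D h) (f (S h2 ∙ y) : K) *: h1 = 0.
  have := contrl_antil h y (f := f) (lin_comp f (@lin_id _ _)).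
  under eq_tlift => x1 x2 do rewrite fh0 scale0r.
  under [RHS]eq_tlift => h1 h2.
    rewrite contrlE fint (is_linZ (f := fun z => h1 ∙ z)); last by multilinear.
    rewrite amul1r; over.
  move=> <-; rewrite /tlift big1 // => k _; rewrite big1 // => l _.
  exact: scaler0.
suff : (f x : K) *: h = 0 by move/eqP; rewrite scaler_eq0 (negbTE fx) => /eqP.
rewrite -(copr_counitr e (F := fun y => (f x : K) *: y)); last by multilinear.
transitivity (\sw_(h1, w <- D h) \sw_(h2, h3 <- D w)
    (f (S h3 ∙ (S (S h2) ∙ x)) : K) *: h1).
  apply: eq_tlift => h1 w; symmetry.
  under eq_tlift => h2 h3 do rewrite amulA -anti_mul.
  rewrite (antil _ _ _ (F := fun y => (f (S y ∙ x) : K) *: h1));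
    last by multilinear.
  by rewrite anti_one amul1l.
rewrite -(copr_coassoc e e _ _ (F := fun h1 h2 h3 =>
  (f (S h3 ∙ (S (S h2) ∙ x)) : K) *: h1)); last by multilinear.
transitivity (\sum_m \sw_(h1, h2 <- D (\sw_(u, h3 <- D h)
    (f (S h3 ∙ vbase m) : K) *: u)) (coor m (S (S h2) ∙ x) : K) *: h1).
  under [RHS]eq_bigr => m _.
    rewrite (tlift_lin (f := fun u => \sw_(h1, h2 <- D u)
      (coor m (S (S h2) ∙ x) : K) *: h1)); last by multilinear.
    over.
  rewrite -tlift_sum; apply: eq_tlift => u h3.
  under [RHS]eq_bigr => m _.
    rewrite (is_linZ (f := fun u => \sw_(h1, h2 <- D u)
      (coor m (S (S h2) ∙ x) : K) *: h1)); last by multilinear.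
    rewrite tlift_lin; last by multilinear.
    over.
  rewrite -tlift_sum; apply: eq_tlift => h1 h2.
  rewrite (coor_sum (f := fun z => (f (S h3 ∙ z) : K) *: h1));
    last by multilinear.
  by apply: eq_bigr => m _; rewrite !scalerA mulrC.
by rewrite big1 // => m _; rewrite h0 linear0 linear0.
Qed.

(** [L] represents [eps] for the nondegenerate form [f (S h ∙ x)]. Taking [h = 1] gives [f L = 1].
    As [S] is injective, hence onto, write [y = S k]: pairing [y ∙ L] with [h] gives [eps (k ∙ h)],
    so [L] is a left integral. *)
Lemma exists_dual_integrals : exists (f : {linear A -> K^o}) (L : A),
  [/\ forall x, \sw_(x1, x2 <- D x) (f x1 : K) *: x2 = (f x : K) *: aone A,
      left_integral1 L & f L = 1].
Proof.
have [f fint fn0] := exists_right_integral.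
have S_surj : forall y, exists x, S x = y.
  apply: inj_lin_surj => [|h Sh0]; first by multilinear.
  apply: (integral_anti_inj fint fn0) => x; rewrite Sh0.
  by rewrite (is_lin0 (f := fun y => f (y ∙ x))) //; multilinear.
have S_nd h : (forall x, f (S h ∙ x) = 0) -> h = 0.
  exact: integral_anti_inj.
have fS_bilin : bilin (fun h x => f (S h ∙ x)) by multilinear.
have [L fL] := left_nondegenerate_repr fS_bilin S_nd eps.
exists f, L; split=> // [y|]; last first.
  by have := fL (aone A); rewrite anti_one amul1l heps_one.
have [k <-] := S_surj y; apply/eqP; rewrite -subr_eq0; apply/eqP.
apply: (left_nondegenerate_right fS_bilin S_nd) => h.
have lin_h : is_lin (fun x => f (S h ∙ x)) by multilinear.
rewrite (is_linB _ _ lin_h) (is_linZ _ _ lin_h) amulA -anti_mul !fL.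
by rewrite heps_mul heps_anti subrr.
Qed.
End Integrals.

(** * Pi-integrals *)

Lemma fdalg_eq0 (K : fieldType) (A : fdAlgType K) (x : A) : aone A = 0 -> x = 0.
Proof.
by move=> A0; rewrite -(amul1r x) A0 (is_lin0 (f := amul x)) //; multilinear.
Qed.

Lemma exists_unit_form (K : fieldType) (A : fdAlgType K) :
  exists u : {linear A -> K^o}, aone A <> 0 -> u (aone A) = 1.
Proof.
have [A0|/eqP A_neq0] := pselect (aone A = 0).
  have lin_const0 : is_lin (fun _ : A => 0 : K^o).
    by move=> c x y; rewrite scaler0 addr0.
  by exists (linear_of lin_const0).
have [i ci] : exists i, coor i (aone A) != 0.
  apply: contrapT => /forallNP c0; move/eqP: A_neq0; apply.
  rewrite (coor_sum (aone A) (@lin_id _ A)) big1 // => i _.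
  by have /negP/negPn/eqP-> := c0 i; rewrite scale0r.
exists (linear_of (lin_scale (coor i (aone A))^-1
  (lin_comp (coor i) (@lin_id _ A)))) => _.
exact: mulVf.
Qed.

(** * Extending a right integral of [H 1] to all components *)

Section PiIntegral.
Variables (K : fieldType) (G : groupType) (H : hopfPiCoalg K G).
Implicit Types a b c : G.

Let u a : {linear H a -> K^o} := projT1 (cid (exists_unit_form (H a))).
Let u1 a : aone (H a) <> 0 -> u a (aone (H a)) = 1 :=
  projT2 (cid (exists_unit_form (H a))).

(** Write y ⊗ 1 as the sum of y1 ⊗ S(y2) y3. Regrouping and using coinvariance turns it into 1 ⊗ y,
    and a form with value 1 at the unit reads off the scalar. A zero component is treated apart. *)
Let coinvariant_scalar a (e : a = (1 * a)%g) (y : H a) :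
  copr e y = aone (H 1%g) ⊗ y -> y = (u a y : K) *: aone (H a).
Proof.
move=> ey; have [/fdalg_eq0 H0|H1] := pselect (aone (H a) = 0).
  by rewrite (H0 y) (H0 (aone _)) scaler0.
suff /(congr1 (tforml (u a))) : y ⊗ aone (H a) = aone (H a) ⊗ y.
  by rewrite !tformlE u1 // scale1r.
have eb' : a = a^-1^-1%g by rewrite invgK.
have e1 : a = (a * 1)%g by rewrite mulg1.
have e2 : 1%g = (a^-1 * a)%g by rewrite mulVg.
have e3 : 1%g = (a * a^-1)%g by rewrite mulgV.
rewrite -(copr_counitr e1 (F := fun p => p ⊗ aone (H a))); last by multilinear.
transitivity (\sw_(p, w <- copr e1 y) \sw_(q, r <- copr e2 w)
    (p ⊗ (anti eb' q ∙ r))).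
  apply: eq_tlift => p w.
  by rewrite (antil _ _ _ (F := fun z => p ⊗ z)); last by multilinear.
rewrite -(copr_coassoc e3 e _ _ (F := fun p q r => p ⊗ (anti eb' q ∙ r)));
  last by multilinear.
rewrite ey tliftE; last by multilinear.
rewrite copr_one tliftE; last by multilinear.
by rewrite anti_one amul1l.
Qed.

Variable f : {linear H 1%g -> K^o}.
Hypothesis f_integral : forall (e : 1%g = (1 * 1)%g :> G) (x : H 1%g),
  \sw_(x1, x2 <- copr e x) (f x1 : K) *: x2 = (f x : K) *: aone (H 1%g).

Let ext_form a (x : H a) : K^o :=
  u a (\sw_(x1, x2 <- copr (esym (mul1g a)) x) (f x1 : K) *: x2).

Let ext_form_lin a : is_lin (@ext_form a).
Proof. by rewrite /ext_form; multilinear. Qed.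

Let ext a : {linear H a -> K^o} := linear_of (@ext_form_lin a).

(** Coassociativity and integrality of [f] make the left side coinvariant, hence scalar; [ext] was
    defined as that scalar. *)
Let ext_contr a (e : a = (1 * a)%g) (x : H a) :
  \sw_(x1, x2 <- copr e x) (f x1 : K) *: x2 = (ext a x : K) *: aone (H a).
Proof.
rewrite [ext a x]/(ext_form x) /ext_form (eq_irrelevance (esym _) e).
apply: (@coinvariant_scalar a e).
rewrite (tlift_lin (f := copr e)); last by multilinear.
transitivity (\sw_(x1, w <- copr e x) \sw_(p, q <- copr e w)
  (f x1 : K) *: (p ⊗ q)).
  apply: eq_tlift => x1 w; rewrite -(tlift_lin (f := fun y => (f x1 : K) *: y));
    last by multilinear.
  by rewrite tlift_id (is_linZ (f := copr e)); last by multilinear.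
have e11 : 1%g = (1 * 1)%g :> G by rewrite mul1g.
rewrite -(copr_coassoc e11 e _ _ (F := fun x1 p q => (f x1 : K) *: (p ⊗ q)));
  last by multilinear.
rewrite (tlift_lin (f := fun y => aone _ ⊗ y)); last by multilinear.
apply: eq_tlift => z q.
transitivity ((\sw_(x1, p <- copr e11 z) (f x1 : K) *: p) ⊗ q).
  rewrite (tlift_lin (f := fun y => y ⊗ q)); last by multilinear.
  apply: eq_tlift => x1 p; rewrite (is_linZ (f := fun y => y ⊗ q)) //.
  by multilinear.
rewrite f_integral (is_linZ (f := fun y => y ⊗ q)); last by multilinear.
by rewrite (is_linZ (f := fun y => aone _ ⊗ y)); last by multilinear.
Qed.

(* Contrapositively, the indices of nonzero components form a subgroup. *)
Let unit_eq0 a b c (e : c = (a * b)%g) (x : H c) :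
  aone (H a) = 0 -> x = 0 \/ aone (H b) = 0.
Proof.
move=> Ha0; pose d := b^-1%g.
have ed : d = b^-1%g by [].
have eb : b = d^-1%g by rewrite invgK.
have [Hd0|Hd] := pselect (aone (H d) = 0).
  by right; rewrite -(anti_one _ eb) Hd0 linear0.
left; have e1 : c = (c * 1)%g by rewrite mulg1.
have e2 : 1%g = (d * b)%g by rewrite mulVg.
have e3 : a = (c * d)%g by rewrite e mulgK.
suff /(congr1 (tformr (u d))) : x ⊗ aone (H d) = 0.
  by rewrite tformrE u1 // scale1r /tformr linear0.
rewrite -(copr_counitr e1 (F := fun p => p ⊗ aone (H d))); last by multilinear.
transitivity (\sw_(p, w <- copr e1 x) \sw_(q, r <- copr e2 w)
    (p ⊗ (q ∙ anti ed r))).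
  apply: eq_tlift => p w.
  by rewrite (antir _ _ _ (F := fun z => p ⊗ z)); last by multilinear.
rewrite -(copr_coassoc e3 e _ _ (F := fun p q r => p ⊗ (q ∙ anti ed r)));
  last by multilinear.
transitivity (\sw_(z, r <- copr e x) (0 : tensor (H c) (H d))).
  by apply: eq_tlift => z r; rewrite (fdalg_eq0 z Ha0) !linear0.
by rewrite /tlift big1 // => i _; rewrite big1 // => j _; rewrite scaler0.
Qed.

(** If [H a] is nonzero, tensor with its unit: [ext_contr] replaces [ext a x1] times the unit by a
    contraction with [f], and coassociativity exhibits the result as the coproduct of [ext c x]
    times the unit. If [H a] is zero, [unit_eq0] makes the right side vanish. *)
Let ext_integral a b c (e : c = (a * b)%g) (x : H c) :
  \sw_(x1, x2 <- copr e x) (ext a x1 : K) *: x2 = (ext c x : K) *: aone (H b).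
Proof.
have [Ha0|Ha] := pselect (aone (H a) = 0).
  have -> : (ext c x : K) *: aone (H b) = 0.
    have [->|->] := unit_eq0 e x Ha0; last exact: scaler0.
    by rewrite linear0 scale0r.
  rewrite /tlift big1 // => i _; rewrite big1 // => j _.
  by rewrite (fdalg_eq0 (vbase i) Ha0) linear0 scale0r scaler0.
have ea : a = (1 * a)%g by rewrite mul1g.
have ec : c = (1 * c)%g by rewrite mul1g.
suff /(congr1 (tforml (u a))) :
    aone (H a) ⊗ (\sw_(x1, x2 <- copr e x) (ext a x1 : K) *: x2) =
    aone (H a) ⊗ ((ext c x : K) *: aone (H b)).
  by rewrite !tformlE u1 // !scale1r.
rewrite (tlift_lin (f := fun y => aone (H a) ⊗ y)); last by multilinear.
transitivity (\sw_(x1, x2 <- copr e x) \sw_(p, q <- copr ea x1)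
    (f p : K) *: (q ⊗ x2)).
  apply: eq_tlift => x1 x2.
  rewrite (is_linZ (f := fun y => aone _ ⊗ y)); last by multilinear.
  rewrite -(is_linZ (f := fun y => y ⊗ x2)); last by multilinear.
  rewrite -(ext_contr ea) (tlift_lin (f := fun y => y ⊗ x2));
    last by multilinear.
  apply: eq_tlift => p q.
  by rewrite (is_linZ (f := fun y => y ⊗ x2)); last by multilinear.
rewrite (copr_coassoc ea e e ec (F := fun p q x2 => (f p : K) *: (q ⊗ x2)));
  last by multilinear.
transitivity (copr e ((ext c x : K) *: aone (H c))).
  rewrite -(ext_contr ec) (tlift_lin (f := copr e)); last by multilinear.
  apply: eq_tlift => p z; rewrite (is_linZ (f := copr e)); last by multilinear.
  rewrite -[in RHS](tlift_id (copr e z)).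
  by rewrite (tlift_lin (f := fun y => (f p : K) *: y)); last by multilinear.
rewrite (is_linZ (f := copr e)) ?copr_one; last by multilinear.
by rewrite (is_linZ (f := fun y => aone (H a) ⊗ y)); last by multilinear.
Qed.

Lemma right_integral_extension : exists lam : forall a, {linear H a -> K^o},
  right_pi_integral lam /\ forall x, lam 1%g x = f x.
Proof.
exists ext; split=> [a b x|x]; first exact: (ext_integral erefl x).
have e11 : 1%g = (1 * 1)%g :> G by rewrite mul1g.
have /eqP := ext_contr e11 x; rewrite f_integral -subr_eq0 -scalerBl.
rewrite scaler_eq0 (negbTE (hcar1_neq0 H)) orbF subr_eq0 => /eqP ->.
by [].
Qed.
End PiIntegral.

Lemma exists_dual_pi_integrals (K : fieldType) (G : groupType)
    (H : hopfPiCoalg K G) :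
  exists (lam : forall a, {linear H a -> K^o}) (L : H 1%g),
  [/\ right_pi_integral lam, left_integral1 L & lam 1%g L = 1].
Proof.
have e : 1%g = (1 * 1)%g :> G by rewrite mul1g.
have e1 : 1%g = (1^-1)%g :> G by rewrite invg1.
have [f [L [fint Lint fL]]] := exists_dual_integrals H e e1.
have [|lam [lint lE]] := @right_integral_extension K G H f.
  by move=> e' x; rewrite (eq_irrelevance e' e).
by exists lam, L; split=> //; rewrite lE.
Qed.

(** * Crossings and R-matrices *)

Section Crossing.
Variables (K : fieldType) (G : groupType) (H : crossedHopfPiCoalg K G).
Implicit Types (a b c d : G) (W : vectType K).
Local Notation eps := (heps H).
Local Notation cast e := (icast (fun a => hcar H a) e).

Definition cross b a d (e : d = lconj b a) : {linear H a -> H d} :=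
  linear_of (lin_comp (cast (esym e)) (lin_comp (hphi H b a) (@lin_id K (H a)))).

Lemma cross_one b a d (e : d = lconj b a) : cross e (aone (H a)) = aone (H d).
Proof. by have [+ _ _ _] := hphiP H => /(_ b a) [[]]; subst d. Qed.

Lemma cross_mul b a d (e : d = lconj b a) (x y : H a) :
  cross e (x ∙ y) = cross e x ∙ cross e y.
Proof. by have [+ _ _ _] := hphiP H => /(_ b a) [[_ M] _]; subst d; apply: M. Qed.

Lemma cross_inj b a d (e : d = lconj b a) : injective (cross e).
Proof.
by have [+ _ _ _] := hphiP H => /(_ b a) [_ /bij_inj]; subst d.
Qed.

Lemma cross_comp b b' bb' a d d' (e' : d = lconj b' a) (e : d' = lconj b d)
    (e'' : d' = lconj bb' a) (ebb : bb' = (b * b')%g) (x : H a) :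
  cross e (cross e' x) = cross e'' x.
Proof.
have [_ _ _ phiM] := hphiP H; subst d bb'; rewrite {2}/cross /= phiM.
subst d'; rewrite /=.
set y := hphi _ _ _ _; have E : lconj b (lconj b' a) = lconj (b * b') a := e''.
rewrite (icast_irr (lconjMl b b' a) E) (icast_irr (esym e'') (esym E)).
by case: _ / E.
Qed.

(** The crossing at 1 is idempotent and injective. *)
Lemma cross_id a (e : a = lconj 1 a) (x : H a) : cross e x = x.
Proof. by apply: (@cross_inj _ _ _ e); rewrite (cross_comp _ _ e) ?mul1g. Qed.

Lemma crossK b a d (e : d = lconj b a) (e' : a = lconj b^-1 d) :
  cancel (cross e) (cross e').
Proof.
move=> x; have e1 : a = lconj 1 a by rewrite /lconj mul1g invg1 mulg1.
by rewrite (cross_comp _ _ e1) ?mulVg // cross_id.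
Qed.

Lemma crossVK b a d (e : d = lconj b a) (e' : a = lconj b^-1 d) :
  cancel (cross e') (cross e).
Proof.
move=> x; have e1 : d = lconj 1 d by rewrite /lconj mul1g invg1 mulg1.
by rewrite (cross_comp _ _ e1) ?mulgV // cross_id.
Qed.

Lemma heps_cross b (e : 1%g = lconj b 1) (x : H 1%g) : eps (cross e x) = eps x.
Proof.
have [_ _ epsphi _] := hphiP H; rewrite -[RHS](epsphi b).
by rewrite (icast_irr (lconj1 b) (esym e)).
Qed.

Lemma copr_cross W g a b c a' b' c' (ea : a' = lconj g a) (eb : b' = lconj g b)
    (ec : c' = lconj g c) (e : c = (a * b)%g) (e' : c' = (a' * b')%g)
    (F : H a' -> H b' -> W) (x : H c) : bilin F ->
  tlift F (copr e' (cross ec x)) =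
  \sw_(u, v <- copr e x) F (cross ea u) (cross eb v).
Proof.
move=> bF; have [_ phiD _ _] := hphiP H; subst c a' b'.
transitivity (tlift F (tmap (hphi H g a) (hphi H g b) (hDelta H a b x))).
  rewrite phiD /copr /= /cross /=; congr (tlift F (hDelta H _ _ _)).
  subst c'; rewrite /=.
  by rewrite (icast_irr e' (lconjM g a b)).
by rewrite tlift_tmap.
Qed.
End Crossing.
Arguments cross {K G H b a d} e.

(** * The R-matrix axioms in Sweedler form *)

Section Rmatrix.
Variables (K : fieldType) (G : groupType) (H : qtHopfPiCoalg K G).
Implicit Types (a b c d : G) (W : vectType K).
Local Notation eps := (heps H).
Local Notation R := (hR H).

Lemma hphiVE b a (x : H (lconj b a)) (e : a = lconj b^-1 (lconj b a)) :
  hphiV x = cross e x.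
Proof. by rewrite /hphiV (icast_irr (lconjK b a) (esym e)). Qed.

Lemma R_inv a b : exists r, inverse_of (R a b) r.
Proof. by have [+ _ _ _ _] := hRP H. Qed.

Lemma R_copr W a b c d (e : c = (a * b)%g) (ed : d = lconj a b)
    (e' : c = (d * a)%g) (eb : b = lconj a^-1 d) (F : H a -> H b -> W)
    (x : H c) : bilin F ->
  \sw_(s, t <- R a b) \sw_(x1, x2 <- copr e x) F (s ∙ x1) (t ∙ x2) =
  \sw_(x1, x2 <- copr e' x) \sw_(s, t <- R a b) F (x2 ∙ s) (cross eb x1 ∙ t).
Proof.
move=> bF; have [_ + _ _ _] := hRP H => /(_ a b); subst c d => /(_ x).
move/(congr1 (tlift F)); rewrite !tlift_mul //.
rewrite tlift_tswap; last by multilinear.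
have lhphiV : is_lin (@hphiV K G H a b).
  by move=> k u v; rewrite !(hphiVE _ eb) linearP.
rewrite tlift_tmap; last first.
  apply: bilinP => [v|u]; last by multilinear.
  by apply: lin_tlift_body => s t; multilinear.
rewrite /copr /= (icast_irr (esym (lconj_mul a b)) e') => ->.
by apply: eq_tlift => x1 x2; apply: eq_tlift => s t; rewrite (hphiVE _ eb).
Qed.

Lemma R_copr_r W a b c bc (e : bc = (b * c)%g) (F : H a -> H b -> H c -> W) :
  trilin F ->
  \sw_(s, t <- R a bc) \sw_(t1, t2 <- copr e t) F s t1 t2 =
  \sw_(s, t <- R a c) \sw_(s', t' <- R a b) F (s ∙ s') t' t.
Proof.
move=> [F1 F2 F3]; have [_ _ + _ _] := hRP H => /(_ a b c); subst bc.
move/(congr1 (fun y => \sw_(s, z <- y) \sw_(t1, t2 <- z) F s t1 t2)).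
rewrite tlift_tmap; last by multilinear.
move=> ->; rewrite tlift_mul; last by multilinear.
rewrite /leg13 /leg12 tlift_tlift; apply: eq_tlift => s t.
rewrite tliftE; last by multilinear.
rewrite -[in LHS](tlift_id (R a b)).
rewrite (tlift_lin (f := fun X => tlift _ (tassoc (X ⊗ aone (H c)))));
  last by rewrite /tassoc; multilinear.
apply: eq_tlift => s' t'; rewrite tassocE.
rewrite tliftE; last by multilinear.
rewrite tens_mulE tliftE; last by multilinear.
by rewrite amul1l amul1r.
Qed.

Lemma R_copr_l W a b ab c d (e : ab = (a * b)%g) (ed : d = lconj b c)
    (ec : c = lconj b^-1 d) (F : H a -> H b -> H c -> W) :
  trilin F ->
  \sw_(s, t <- R ab c) \sw_(s1, s2 <- copr e s) F s1 s2 t =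
  \sw_(p, q <- R a d) \sw_(s, t <- R b c) F p s (cross ec q ∙ t).
Proof.
move=> [F1 F2 F3]; have [_ _ _ + _] := hRP H => /(_ a b c); subst ab d.
move/(congr1 (fun y => \sw_(s, z <- y) \sw_(t1, t2 <- z) F s t1 t2)).
rewrite /tassoc tlift_tlift tlift_tmap; last by multilinear.
have lhphiV : is_lin (@hphiV K G H b c).
  by move=> k u v; rewrite !(hphiVE _ ec) linearP.
rewrite tlift_mul; last by multilinear.
rewrite /leg13 /leg23 tlift_tlift tlift_tmap; last by multilinear.
move=> E; transitivity (\sw_(u, v <- R (a * b)%g c)
  \sw_(s, z <- \sw_(u0, v0 <- hDelta H a b u) (u0 ⊗ (v0 ⊗ v)))
     \sw_(t1, t2 <- z) F s t1 t2).
  apply: eq_tlift => s t; rewrite tlift_tlift; apply: eq_tlift => s1 s2.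
  by rewrite !tliftE //; multilinear.
rewrite E; apply: eq_tlift => p q.
rewrite tliftE; last by multilinear.
rewrite tliftE; last by multilinear.
rewrite amul1r tlift_mul; last by multilinear.
rewrite tliftE; last by multilinear.
by apply: eq_tlift => s t; rewrite amul1l (hphiVE _ ec).
Qed.
End Rmatrix.

(** * Drinfeld elements *)

Section Invertibility.
Variables (K : fieldType) (A : fdAlgType K).

Lemma amul_eq1C (x y : A) : x ∙ y = aone A -> y ∙ x = aone A.
Proof.
move=> xy; have [|z yz0|z yz] := @inj_lin_surj _ _ (fun z => y ∙ z) _ _ (aone A).
- by multilinear.
- by rewrite -[z]amul1l -xy -amulA yz0 (is_lin0 (f := amul x)) //; multilinear.
suff -> : x = z by [].
by rewrite -[x]amul1r -yz amulA xy amul1l.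
Qed.

Lemma ainvP (x y : A) : x ∙ y = aone A -> ainv x ∙ x = aone A.
Proof.
move=> xy; have : exists z, inverse_of x z.
  by exists y; split=> //; apply: amul_eq1C.
by move/(@xgetPex _ 0 [set z | inverse_of x z]%classic) => -[].
Qed.
End Invertibility.

Section DrinfeldElements.
Variables (K : fieldType) (G : groupType) (H : qtHopfPiCoalg K G).
Implicit Types a b c d : G.
Local Notation eps := (heps H).
Local Notation R := (hR H).
Local Notation one a := (aone (H a)).

Let e11 : 1%g = (1 * 1)%g :> G. Proof. by rewrite mul1g. Qed.

(** Apply [eps] to the middle leg of the first half of axiom (ii) at [1 = 1 * 1]. This gives R = R
    (E ⊗ 1), and R cancels. *)
Lemma R_counit_r a : \sw_(s, t <- R a 1%g) (eps t : K) *: s = one a.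
Proof.
set E := LHS; have [r [_ rR]] := R_inv H a 1%g.
suff /(congr1 (tformr eps)) : E ⊗ one 1%g = one a ⊗ one 1%g.
  by rewrite !tformrE heps_one !scale1r.
suff RE : R a 1%g ∙ (E ⊗ one 1%g) = R a 1%g.
  by rewrite -[LHS]amul1l -rR -amulA RE.
rewrite -[LHS]tlift_id tlift_mul; last by multilinear.
under eq_tlift => s t.
  rewrite tliftE; last by multilinear.
  rewrite amul1r (tlift_lin (f := fun s' => (s ∙ s') ⊗ t)); last by multilinear.
  under eq_tlift => s' t'.
    rewrite (is_linZ (f := fun s' => (s ∙ s') ⊗ t)); last by multilinear.
    over.
  over.
rewrite -(R_copr_r e11 (F := fun s t1 t2 => (eps t1 : K) *: (s ⊗ t2)));
  last by multilinear.
rewrite -[RHS]tlift_id; apply: eq_tlift => s t.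
by rewrite (copr_counitl _ (F := fun t => s ⊗ t)); last by multilinear.
Qed.

Lemma R_counit_l c : \sw_(s, t <- R 1%g c) (eps s : K) *: t = one c.
Proof.
set E := LHS; have [r [Rr _]] := R_inv H 1%g c.
have e : c = lconj 1 c by rewrite /lconj mul1g invg1 mulg1.
have e' : c = lconj 1^-1 c by rewrite invg1.
(* The second half of axiom (ii) produces [E] only under the crossing at [1^-1]. *)
apply: (@cross_inj _ _ _ _ _ _ e'); rewrite cross_one.
suff /(congr1 (tforml eps)) : one 1%g ⊗ cross e' E = one 1%g ⊗ one c.
  by rewrite !tformlE heps_one !scale1r.
suff RE : (one 1%g ⊗ cross e' E) ∙ R 1%g c = R 1%g c.
  by rewrite -[LHS]amul1r -Rr amulA RE.
rewrite -[LHS]tlift_id tlift_mul; last by multilinear.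
rewrite tliftE; last by multilinear.
rewrite (tlift_lin (f := fun y => \sw_(s, t <- R 1%g c)
  ((one 1%g ∙ s) ⊗ (cross e' y ∙ t)))); last by multilinear.
under eq_tlift => p q.
  rewrite (is_linZ (f := fun y => \sw_(s, t <- R 1%g c)
    ((one 1%g ∙ s) ⊗ (cross e' y ∙ t)))); last by multilinear.
  rewrite (tlift_lin (f := fun y => (eps p : K) *: y)); last by multilinear.
  under eq_tlift => s t do rewrite amul1l.
  over.
rewrite -(R_copr_l e11 e e' (F := fun s1 s2 t => (eps s1 : K) *: (s2 ⊗ t)));
  last by multilinear.
rewrite -[RHS]tlift_id; apply: eq_tlift => s t.
by rewrite (copr_counitl _ (F := fun s => s ⊗ t)); last by multilinear.
Qed.

Lemma drinfeldE c d (e : c = d^-1%g) (ec : d = lconj c d) :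
  drinfeld H c = \sw_(s, t <- R c d) (anti e (cross ec t) ∙ s).
Proof.
have ed : d = c^-1%g by rewrite e invgK.
subst d; rewrite /drinfeld /tmulmap.
have E x : hSV (icast (fun a => hcar H a) (lconj_inv c) (hphi H c c^-1%g x)) =
    anti e (cross ec x).
  rewrite /hSV /anti /cross /=.
  by rewrite (icast_irr (esym e) (invgK c)) (icast_irr (esym ec) (lconj_inv c)).
transitivity (tlift (@amul K (H c)) (tmap (fun x => anti e (cross ec x)) id
    (tswap (R c c^-1%g)))).
  congr (tlift _ _); rewrite /tmap; apply: eq_tlift => x y.
  by rewrite E.
rewrite tlift_tmap; last exact: amul_bilin.
by rewrite tlift_tswap; last by multilinear.
Qed.

Variables (a b : G) (ea : a = b^-1%g) (eb : b = a^-1%g).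
Local Notation S := (anti ea).
Local Notation S' := (anti eb).

Let ab : 1%g = (a * b)%g. Proof. by rewrite eb mulgV. Qed.
Let ba : 1%g = (b * a)%g. Proof. by rewrite eb mulVg. Qed.

(** The point is [VR]: [R a b] is the image of [R b a] under [S] on the first leg and [S'] after the
    crossing on the second. Both are inverses attached to [R a a]: [RV] splits [R 1 a], [SR] splits
    [R a 1], and an antipode pair and a counit identity finish each. *)
Lemma anti_drinfeld : S (drinfeld H b) = \sw_(s, t <- R a b) (s ∙ S t).
Proof.
have eca : a = lconj b a by rewrite ea lconj_inv.
have ecV : a = lconj b^-1 a by rewrite /lconj -ea mulgK.
rewrite (drinfeldE eb eca) tlift_lin; last by multilinear.
pose V := \sw_(p, q <- R b a) (S p ⊗ cross eca q).
have RV : \sw_(p, q <- R a a) \sw_(v, w <- V) ((p ∙ v) ⊗ (q ∙ w)) = one a ⊗ one a.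
  transitivity (\sw_(p, q <- R a a) \sw_(s, t <- R b a)
      ((p ∙ S s) ⊗ (cross eca (cross ecV q ∙ t)))).
    apply: eq_tlift => p q; rewrite /V tlift_tlift; apply: eq_tlift => s t.
    rewrite tliftE; last by multilinear.
    by rewrite cross_mul crossVK.
  rewrite -(R_copr_l ab eca ecV (F := fun p s t => (p ∙ S s) ⊗ cross eca t));
    last by multilinear.
  under eq_tlift => s t.
    rewrite (antir _ _ _ (F := fun y => y ⊗ cross eca t)); last by multilinear.
    rewrite -(is_linZ (f := fun t => one a ⊗ cross eca t)); last by multilinear.
    over.
  rewrite -(tlift_lin (f := fun t => one a ⊗ cross eca t)); last by multilinear.
  by rewrite R_counit_l cross_one.
have SR : \sw_(s, t <- R a b) \sw_(s', t' <- R a a)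
    ((s ∙ s') ⊗ (S' t' ∙ t)) = one a ⊗ one b.
  rewrite -(R_copr_r ab (F := fun s t1 t2 => s ⊗ (S' t1 ∙ t2)));
    last by multilinear.
  under eq_tlift => s t.
    rewrite (antil _ _ _ (F := fun y => s ⊗ y)); last by multilinear.
    rewrite -(is_linZ (f := fun s => s ⊗ one b)); last by multilinear.
    over.
  rewrite -(tlift_lin (f := fun s => s ⊗ one b)); last by multilinear.
  by rewrite R_counit_r.
have VR : \sw_(v, w <- V) (v ⊗ S' w) = R a b.
  transitivity (\sw_(v, w <- V) ((one a ∙ v) ⊗ (S' w ∙ one b))).
    by apply: eq_tlift => v w; rewrite amul1l amul1r.
  transitivity (\sw_(v, w <- V) \sw_(s, t <- R a b) \sw_(s', t' <- R a a)
     ((s ∙ (s' ∙ v)) ⊗ (S' (t' ∙ w) ∙ t))).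
    apply: eq_tlift => v w.
    rewrite -[LHS](tliftE (b := fun x y => (x ∙ v) ⊗ (S' w ∙ y)));
      last by multilinear.
    rewrite -SR tlift_tlift; apply: eq_tlift => s t.
    rewrite tlift_tlift; apply: eq_tlift => s' t'.
    rewrite tliftE; last by multilinear.
    by rewrite anti_mul !amulA.
  rewrite tlift_exch -[RHS]tlift_id; apply: eq_tlift => s t.
  rewrite tlift_exch.
  transitivity (\sw_(x, y <- one a ⊗ one a) ((s ∙ x) ⊗ (S' y ∙ t))).
    rewrite -RV tlift_tlift; apply: eq_tlift => s' t'.
    rewrite tlift_tlift; apply: eq_tlift => v w.
    by rewrite tliftE; last by multilinear.
  rewrite tliftE; last by multilinear.
  by rewrite amul1r anti_one amul1l.
rewrite -VR tlift_tlift /V tlift_tlift; apply: eq_tlift => p q.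
rewrite tliftE; last by multilinear.
rewrite tliftE; last by multilinear.
by rewrite anti_mul.
Qed.

Variable eab : b = lconj a b.
Let eVb : b = lconj a^-1 b. Proof. by rewrite /lconj -eb mulgK. Qed.
Local Notation W := (\sw_(s, t <- R a b) (s ∙ S t)).

(** Axiom (i) under u ⊗ v -> u S(v); on the side where [R] stands first, x1 S(x2) cancels between
    its legs. *)
Let counit_comm (x : H 1%g) :
  \sw_(x1, x2 <- copr ba x) (x2 ∙ W ∙ S (cross eVb x1)) = (eps x : K) *: W.
Proof.
have RD := R_copr ab eab ba eVb (F := fun u v => u ∙ S v) x.
transitivity (\sw_(x1, x2 <- copr ba x) \sw_(s, t <- R a b)
    ((x2 ∙ s) ∙ S (cross eVb x1 ∙ t))).
  apply: eq_tlift => x1 x2.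
  rewrite (tlift_lin (f := fun y => x2 ∙ y ∙ _)); last by multilinear.
  by apply: eq_tlift => s t; rewrite anti_mul !amulA.
rewrite -RD; last by multilinear.
rewrite (tlift_lin (f := fun y => (eps x : K) *: y)); last by multilinear.
apply: eq_tlift => s t.
under eq_tlift => x1 x2 do rewrite anti_mul amulA -[s ∙ x1 ∙ _]amulA.
by rewrite (antir _ _ _ (F := fun y => s ∙ y ∙ S t)) ?amul1r;
  last by multilinear.
Qed.

(** Split [y], let [counit_comm] expand the counit next to [W], and cancel S'(y1) y2. *)
Let W_comm (y : H a) : y ∙ W = W ∙ S (cross eVb (S' y)).
Proof.
have a1 : a = (a * 1)%g by rewrite mulg1.
have a1' : a = (1 * a)%g by rewrite mul1g.
symmetry; rewrite -(copr_counitr a1 (F := fun y => W ∙ S (cross eVb (S' y))));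
  last by multilinear.
transitivity (\sw_(y1, z <- copr a1 y) \sw_(y2, y3 <- copr ba z)
    (y3 ∙ W ∙ S (cross eVb (S' y1 ∙ y2)))).
  apply: eq_tlift => y1 z; rewrite -(is_linZ (f := fun y => y ∙ _));
    last by multilinear.
  rewrite -counit_comm (tlift_lin (f := fun y => y ∙ _)); last by multilinear.
  by apply: eq_tlift => y2 y3; rewrite cross_mul anti_mul !amulA.
rewrite -(copr_coassoc ab a1' _ _
  (F := fun y1 y2 y3 => y3 ∙ W ∙ S (cross eVb (S' y1 ∙ y2))));
  last by multilinear.
under eq_tlift => z y3.
  rewrite (antil _ _ _ (F := fun x => y3 ∙ W ∙ S (cross eVb x)));
    last by multilinear.
  rewrite cross_one anti_one amul1r; over.
by rewrite (copr_counitl _ (F := fun y => y ∙ W)); last by multilinear.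
Qed.

Lemma anti_drinfeld_unit : exists x, S (drinfeld H b) ∙ x = one a.
Proof.
have [r [_ rR]] := R_inv H a b.
(* The map u ⊗ v -> u S(v) takes [r ∙ R a b = 1] to the sum of v W S(w) being 1; [W_comm] then pulls
   [W] to the left. *)
exists (\sw_(v, w <- r) (S (cross eVb (S' v)) ∙ S w)); rewrite anti_drinfeld.
have := congr1 (tlift (fun u v => u ∙ S v)) rR.
rewrite tlift_mul; last by multilinear.
rewrite tens_oneE tliftE; last by multilinear.
rewrite anti_one amul1r => <-.
rewrite (tlift_lin (f := amul W)); last by multilinear.
apply: eq_tlift => v w; rewrite amulA -W_comm.
rewrite (tlift_lin (f := fun y => v ∙ y ∙ S w)); last by multilinear.
by apply: eq_tlift => s t; rewrite anti_mul !amulA.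
Qed.
End DrinfeldElements.

(** * The distinguished grouplike element *)

Section DistinguishedGrouplike.
Variables (K : fieldType) (G : groupType) (H : qtHopfPiCoalg K G).
Implicit Types a b c d : G.
Local Notation eps := (heps H).
Local Notation R := (hR H).
Local Notation one a := (aone (H a)).

Variable nu : {linear H 1%g -> K^o}.
Hypothesis nuP : distinguished_dual_grouplike nu.

(** The crossing carries [L] to a nonzero left integral, so [nu] can be read off from either of the
    two. *)
Lemma nu_cross a (e : 1%g = lconj a 1) (x : H 1%g) : nu (cross e x) = nu x.
Proof.
have [_ nuL] := nuP.
have [lam [L [_ Lint lamL]]] := exists_dual_pi_integrals H.
have eV : 1%g = lconj a^-1 1 by rewrite lconj1.
have L'int : left_integral1 (cross e L).
  move=> y; rewrite -{1}(crossVK e eV y) -cross_mul Lint heps_cross.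
  by rewrite (is_linZ (f := cross e)); last by multilinear.
have L'neq0 : cross e L != 0.
  apply/eqP => L0; have : L = 0.
    by apply: (@cross_inj _ _ _ _ _ _ e); rewrite L0 linear0.
  by move=> L00; move/eqP: lamL; rewrite L00 linear0 eq_sym oner_eq0.
have /eqP := nuL _ L'int (cross e x).
rewrite -cross_mul (nuL _ Lint) (is_linZ (f := cross e)); last by multilinear.
by rewrite -subr_eq0 -scalerBl scaler_eq0 (negbTE L'neq0) orbF subr_eq0 => /eqP.
Qed.

Definition nu_R a : H a := \sw_(s, t <- R a 1%g) (nu t : K) *: s.

Lemma nu_R_grouplike : pi_grouplike nu_R.
Proof.
have [[nu1 nuM] _] := nuP; split=> [a b|].
  have eb : 1%g = lconj b 1 by rewrite lconj1.
  have ebV : 1%g = lconj b^-1 1 by rewrite lconj1.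
  rewrite -[hDelta H a b _]/(copr (erefl (a * b)%g) _) /nu_R.
  rewrite (tlift_lin (f := copr _)); last by multilinear.
  transitivity (\sw_(s, t <- R (a * b)%g 1%g) \sw_(s1, s2 <- copr erefl s)
      (nu t : K) *: (s1 ⊗ s2)).
    apply: eq_tlift => s t.
    rewrite (is_linZ (f := copr _)); last by multilinear.
    rewrite -[in LHS](tlift_id (copr _ s)).
    by rewrite (tlift_lin (f := fun y => (nu t : K) *: y)); last by multilinear.
  rewrite (R_copr_l _ eb ebV (F := fun s1 s2 t => (nu t : K) *: (s1 ⊗ s2)));
    last by multilinear.
  rewrite (tlift_lin (f := fun y => y ⊗ _)); last by multilinear.
  apply: eq_tlift => p q; rewrite tlift_lin; last by multilinear.
  apply: eq_tlift => s t.
  rewrite nuM nu_cross (is_linZ (f := fun y => y ⊗ _)); last by multilinear.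
  rewrite (is_linZ (f := fun y => p ⊗ y)); last by multilinear.
  by rewrite scalerA.
rewrite /nu_R tlift_lin; last by multilinear.
transitivity (nu (\sw_(s, t <- R 1%g 1%g) (eps s : K) *: t)).
  rewrite tlift_lin; last by multilinear.
  apply: eq_tlift => s t.
  rewrite (is_linZ (f := eps)); last by multilinear.
  rewrite (is_linZ (f := nu)); last by multilinear.
  exact: mulrC.
by rewrite R_counit_l nu1.
Qed.

Variables (g : forall a, H a) (phihat : G -> K).
Hypotheses (gP : distinguished_pi_grouplike g)
  (phihatP : crossing_character H phihat).
Variables (a b : G) (ea : a = b^-1%g) (eb : b = a^-1%g) (eab : b = lconj a b).
Local Notation S := (anti ea).

Let ab : 1%g = (a * b)%g. Proof. by rewrite eb mulgV. Qed.
Let ba : 1%g = (b * a)%g. Proof. by rewrite eb mulVg. Qed.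
Let b1 : b = (b * 1)%g. Proof. by rewrite mulg1. Qed.
Let lb : b = (1 * b)%g. Proof. by rewrite mul1g. Qed.
Let eVb : b = lconj a^-1 b. Proof. by rewrite /lconj -eb mulgK. Qed.
Let e1 : 1%g = lconj a 1. Proof. by rewrite lconj1. Qed.

Lemma lam_cross (lam : forall a, {linear H a -> K^o}) c d d' (e : d' = lconj c d)
    (x : H d) : right_pi_integral lam ->
  lam d' (cross e x) = phihat c * lam d x.
Proof.
by have [_ _ chiP] := phihatP => lamP; subst d'; apply: chiP; right.
Qed.

Lemma phihatV c : phihat c^-1 = (phihat c)^-1.
Proof.
have [nz chiM _] := phihatP; apply: (mulfI (nz c)); rewrite -chiM mulgV divff //.
by apply: (mulfI (nz 1%g)); rewrite -chiM mulg1 mulr1.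
Qed.

(** * Moving a factor out of a pi-integral *)

Section Shift.
Variable lam : forall a, {linear H a -> K^o}.
Hypothesis lamP : right_pi_integral lam.

Let lam_r c d cd (e : cd = (c * d)%g) (x : H cd) :
  \sw_(x1, x2 <- copr e x) (lam c x1 : K) *: x2 = (lam cd x : K) *: one d.
Proof. by subst cd; apply: lamP. Qed.

Let lam_l c d cd (e : cd = (c * d)%g) (x : H cd) :
  \sw_(x1, x2 <- copr e x) (lam d x2 : K) *: x1 = (lam cd x : K) *: g c.
Proof. by subst cd; have [_] := gP; apply. Qed.

(** The defining property of [g] expands [lam 1 (y2 ∙ x)] times [g a] into a coproduct of [y2 ∙ x];
    then S(y1) y2 cancels. [shift_integral] is the mirror image, with the right integral property in
    place of that of [g]. *)
Lemma shift_distinguished (y : H b) (x : H 1%g) :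
  \sw_(x1, x2 <- copr ab x) (lam b (y ∙ x2) : K) *: x1 =
  \sw_(y1, y2 <- copr b1 y) (lam 1%g (y2 ∙ x) : K) *: (S y1 ∙ g a).
Proof.
symmetry.
transitivity (\sw_(y1, z <- copr b1 y) \sw_(y2, y3 <- copr ab z)
    \sw_(x1, x2 <- copr ab x) (lam b (y3 ∙ x2) : K) *: (S y1 ∙ y2 ∙ x1)).
  apply: eq_tlift => y1 z; rewrite -(is_linZ (f := amul (S y1)));
    last by multilinear.
  rewrite -(lam_l ab) tlift_copr_mul; last by multilinear.
  rewrite tlift_lin; last by multilinear.
  apply: eq_tlift => y2 y3; rewrite tlift_lin; last by multilinear.
  apply: eq_tlift => x1 x2; rewrite (is_linZ (f := amul (S y1))) ?amulA //.
  by multilinear.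
rewrite -(copr_coassoc ba lb _ _ (F := fun y1 y2 y3 =>
    \sw_(x1, x2 <- copr ab x) (lam b (y3 ∙ x2) : K) *: (S y1 ∙ y2 ∙ x1)));
  last by multilinear.
under eq_tlift => z y3.
  rewrite (antil _ _ _ (F := fun u => \sw_(x1, x2 <- copr ab x)
    (lam b (y3 ∙ x2) : K) *: (u ∙ x1))); last by multilinear.
  under [X in _ *: X]eq_tlift => x1 x2 do rewrite amul1l.
  over.
by rewrite (copr_counitl _ (F := fun y3 => \sw_(x1, x2 <- copr ab x)
  (lam b (y3 ∙ x2) : K) *: x1)); last by multilinear.
Qed.

Lemma shift_integral (y : H b) (x : H 1%g) :
  \sw_(x1, x2 <- copr ba x) (lam b (x1 ∙ y) : K) *: x2 =
  \sw_(y1, y2 <- copr lb y) (lam 1%g (x ∙ y1) : K) *: S y2.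
Proof.
symmetry.
transitivity (\sw_(z, y3 <- copr lb y) \sw_(y1, y2 <- copr ba z)
    \sw_(x1, x2 <- copr ba x) (lam b (x1 ∙ y1) : K) *: (x2 ∙ (y2 ∙ S y3))).
  apply: eq_tlift => z y3.
  transitivity (((lam 1%g (x ∙ z) : K) *: one a) ∙ S y3).
    rewrite (is_linZ (f := fun u => u ∙ S y3)) ?amul1l //.
    by multilinear.
  rewrite -(lam_r ba) tlift_copr_mul; last by multilinear.
  rewrite tlift_exch.
  rewrite (tlift_lin (f := fun u => u ∙ S y3)); last by multilinear.
  apply: eq_tlift => y1 y2.
  rewrite (tlift_lin (f := fun u => u ∙ S y3)); last by multilinear.
  apply: eq_tlift => x1 x2; rewrite (is_linZ (f := fun u => u ∙ S y3)) ?amulA //.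
  by multilinear.
rewrite (copr_coassoc ba lb ab b1 (F := fun y1 y2 y3 =>
    \sw_(x1, x2 <- copr ba x) (lam b (x1 ∙ y1) : K) *: (x2 ∙ (y2 ∙ S y3))));
  last by multilinear.
under eq_tlift => y1 z.
  rewrite (antir _ _ _ (F := fun u => \sw_(x1, x2 <- copr ba x)
    (lam b (x1 ∙ y1) : K) *: (x2 ∙ u))); last by multilinear.
  under [X in _ *: X]eq_tlift => x1 x2 do rewrite amul1r.
  over.
by rewrite (copr_counitr _ (F := fun y1 => \sw_(x1, x2 <- copr ba x)
  (lam b (x1 ∙ y1) : K) *: x2)); last by multilinear.
Qed.
End Shift.

Lemma distinguished_drinfeld :
  S (drinfeld H b) ∙ g a = (phihat a)^-1 *: (drinfeld H a ∙ nu_R a).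
Proof.
have [lam [L [lamP Lint lamL]]] := exists_dual_pi_integrals H.
have RD := R_copr ab eab ba eVb (F := fun u v => (lam b v : K) *: u) L.
transitivity (\sw_(s, t <- R a b) \sw_(x1, x2 <- copr ab L)
    (lam b (t ∙ x2) : K) *: (s ∙ x1)).
  transitivity (\sw_(s, t <- R a b) \sw_(t1, t2 <- copr b1 t)
      (lam 1%g (t2 ∙ L) : K) *: (s ∙ (S t1 ∙ g a))); last first.
    apply: eq_tlift => s t.
    transitivity (s ∙ \sw_(x1, x2 <- copr ab L) (lam b (t ∙ x2) : K) *: x1).
      rewrite (shift_distinguished lamP) tlift_lin; last by multilinear.
      by apply: eq_tlift => t1 t2; rewrite (is_linZ (f := amul s));
        last by multilinear.
    rewrite tlift_lin; last by multilinear.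
    by apply: eq_tlift => x1 x2; rewrite (is_linZ (f := amul s));
      last by multilinear.
  (* Splitting [b = b * 1] puts the second leg of [R a 1] next to [L], which absorbs it through
     [eps]. *)
  rewrite (R_copr_r b1 (F := fun s t1 t2 =>
    (lam 1%g (t2 ∙ L) : K) *: (s ∙ (S t1 ∙ g a)))); last by multilinear.
  rewrite anti_drinfeld //.
  transitivity (\sw_(s, t <- R a 1%g) (eps t : K) *:
      (s ∙ (\sw_(s', t' <- R a b) (s' ∙ S t')) ∙ g a)).
    rewrite -[X in X ∙ g a]amul1l -(R_counit_r H a).
    rewrite (tlift_lin (f := fun u => u ∙ _ ∙ g a)); last by multilinear.
    apply: eq_tlift => s t.
    by rewrite (is_linZ (f := fun u => u ∙ _ ∙ g a)); last by multilinear.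
  apply: eq_tlift => s t.
  rewrite (tlift_lin (f := fun u => (eps t : K) *: (s ∙ u ∙ g a)));
    last by multilinear.
  apply: eq_tlift => s' t'; rewrite Lint linearZ lamL !amulA.
  by rewrite -[X in _ = X *: _]/((eps t : K) * 1) mulr1.
rewrite RD; last by multilinear.
pose chi := (phihat a)^-1.
transitivity (\sw_(s, t <- R a b) \sw_(x1, x2 <- copr ba L)
    chi *: ((lam b (x1 ∙ cross eab t) : K) *: (x2 ∙ s))).
  rewrite tlift_exch; apply: eq_tlift => s t; apply: eq_tlift => x1 x2.
  rewrite scalerA; congr (_ *: _).
  (* The crossing at [a^-1] is pulled off the whole product under [lam b], so [t] reappears crossed
     by [a]. *)
  by rewrite /chi -phihatV -(lam_cross eVb) // cross_mul crossK.
transitivity (\sw_(s, t <- R a b) \sw_(t1, t2 <- copr lb t)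
    chi *: ((nu t1 : K) *: (S (cross eab t2) ∙ s))).
  apply: eq_tlift => s t.
  transitivity (chi *: ((\sw_(x1, x2 <- copr ba L)
      (lam b (x1 ∙ cross eab t) : K) *: x2) ∙ s)).
    rewrite (tlift_lin (f := fun u => chi *: (u ∙ s))); last by multilinear.
    apply: eq_tlift => x1 x2.
    by rewrite (is_linZ (f := fun u => u ∙ s)); last by multilinear.
  rewrite (shift_integral lamP) (copr_cross e1 eab eab lb lb);
    last by multilinear.
  rewrite (tlift_lin (f := fun u => chi *: (u ∙ s))); last by multilinear.
  apply: eq_tlift => t1 t2.
  rewrite (is_linZ (f := fun u => u ∙ s)); last by multilinear.
  (* [L] absorbs the crossed leg [t1] on its right through [nu], which does not see the crossing. *)
  have [_ nuL] := nuP; rewrite nuL // nu_cross (is_linZ (f := lam 1%g)).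
    by rewrite lamL; congr (chi *: _); congr (_ *: _); exact: mulr1.
  by multilinear.
rewrite (R_copr_r lb (F := fun s t1 t2 =>
  chi *: ((nu t1 : K) *: (S (cross eab t2) ∙ s)))); last by multilinear.
rewrite (drinfeldE H ea eab).
rewrite (tlift_lin (f := fun u => chi *: (u ∙ nu_R a))); last by multilinear.
apply: eq_tlift => s t; rewrite /nu_R.
rewrite (tlift_lin (f := fun u => chi *: (_ ∙ u))); last by multilinear.
apply: eq_tlift => s' t'; rewrite amulA (is_linZ (f := amul _)) //.
by multilinear.
Qed.
End DistinguishedGrouplike.

Theorem theorem6 (K : fieldType) (G : groupType) (H : qtHopfPiCoalg K G)
    (g : forall a : G, H a) (nu : {linear H 1%g -> K^o}) (phihat : G -> K)
    (hg : distinguished_pi_grouplike g)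
    (hnu : distinguished_dual_grouplike nu)
    (hphihat : crossing_character H phihat) :
  let h : forall a : G, H a := fun a => tformr nu (hR H a 1%g) in
  pi_grouplike h /\
  (forall a : G, g a = (phihat a)^-1 *: (hell H a ∙ h a)).
Proof.
move=> h; split=> [|a]; first exact: nu_R_grouplike hnu.
have ea : a = a^-1^-1%g by rewrite invgK.
have eab : a^-1%g = lconj a a^-1 by rewrite lconj_inv.
have uE : hSV (drinfeld H a^-1%g) = anti ea (drinfeld H a^-1%g).
  by rewrite /hSV /anti /= (icast_irr (esym ea) (invgK a)).
(* A right inverse suffices: in finite dimension it is two-sided, so [ainv] takes its genuine
   value. *)
have [w uw] := anti_drinfeld_unit H ea erefl eab.
rewrite /hell uE -amulA -(is_linZ (f := amul _)); last by multilinear.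
rewrite -[_ *: _](distinguished_drinfeld hnu hg hphihat ea erefl eab).
by rewrite amulA (ainvP uw) amul1l.
Qed.
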